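(* Let $X$ be a piecewise deterministic Markov process satisfying the assumptions of the context, with jump times $T_1<T_2<\cdots$, and let $Z_k=(W_k,Q_k)$ with $W_k=X_{T_k-}$, $Q_k=X_{T_k}$ be the embedded Markov chain with state space $\mathbb E^\star\times\mathbb E$. Let $\|\xi\|=\int_{\mathbb E}\lambda(u)\,\nu(du)+\sigma(\Gamma)$. Then the probability measure $\pi$ on $\mathbb E^\star\times\mathbb E$ determined by $$\pi(A,B)=\frac1{\|\xi\|}\Big(\int_{A\cap\mathbb E}\lambda(x)\mu_x(B)\,\nu(dx)+\int_{A\cap\Gamma}\mu_x(B)\,\sigma(dx)\Big)$$ for Borel sets $A\subseteq\mathbb E^\star$, $B\subseteq\mathbb E$ (where $\pi(A,B)$ is the mass of $A\times B$), is a stationary measure for the Markov chain $(Z_k)$.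
   Context: **PDMP.** Let $K=\{1,\dots,k\}$. For $i\in K$ let $\mathbb E_i^\circ\subseteq\mathbb R^{d_i}$ be open with boundary $\partial\mathbb E_i$, and let $r_i:\mathbb E_i^\circ\to\mathbb R^{d_i}$ be locally Lipschitz. The flow $\varphi_i(x,t)$ is the unique (non-exploding) solution of $\partial_t\varphi_i(x,t)=r_i(\varphi_i(x,t))$, $\varphi_i(x,0)=x$, followed (in both time directions) until it leaves $\mathbb E_i^\circ$ and extended by continuity to the boundary points where it leaves or enters. The active boundary is $\Gamma_i=\{z\in\partial\mathbb E_i: z=\varphi_i(x,t)\text{ for some }x\in\mathbb E_i^\circ,t>0\}$, the passive boundary is $\Gamma_i^\star=\{z\in\partial\mathbb E_i: z=\varphi_i(x,-t)\text{ for some }x\in\mathbb E_i^\circ,t>0\}$; $\mathbb E_i=\mathbb E_i^\circ\cup\Gamma_i^\star$, $\mathbb E_i^\star=\mathbb E_i^\circ\cup\Gamma_i$. The symbols $\mathbb E^\circ,\mathbb E,\mathbb E^\star,\Gamma,\Gamma^\star$ denote the disjoint unions over $i\in K$; the index $i$ is suppressed. Let $\tau(x)=\inf\{t\ge0:\varphi(x,t)\in\Gamma\}$ ($\inf\emptyset=\infty$). Given a measurable jump intensity $\lambda:\mathbb E\to[0,\infty)$ and jump measures $\mu_x$ (probability measures on $\mathbb E$, $x\in\mathbb E\cup\Gamma$), the PDMP $X$ with state space $\mathbb E$ started at $x$ follows $X_t=\varphi(x,t)$ for $t<T_1$, where $P_x(T_1>t)=1_{\{t<\tau(x)\}}\exp(-\int_0^t\lambda(\varphi(x,u))\,du)$;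 at $T_1$ it jumps to a point with distribution $\mu_{\varphi(x,T_1)}$ and restarts from there. $T_1<T_2<\dots$ are the jump times, $N_t$ is the number of jumps in $[0,t]$, and $N_t^+(B)$, $B\subseteq\Gamma$ Borel, is the number of jumps in $[0,t]$ at which $X_{T_n-}\in B$ (forced jumps). **Notation.** $\tau(x,B)=t$ if the flow from $x$ reaches $B$ (first) at time $t\ge0$, $=\infty$ if it never does; $\partial_hB=\{x\in\mathbb E:\tau(x,B)<h\}$. **Standing assumptions.** (A1) For each $x\in\mathbb E$ there is $\varepsilon(x)>0$ with $\int_0^{\varepsilon(x)}\lambda(\varphi(x,s))ds<\infty$. (A2) $\int_0^\infty\lambda(\varphi(x,s))ds=\infty$ whenever $\tau(x)=\infty$. (A3) $E_x(N_t)<\infty$ for all $x\in\mathbb E,t>0$. (A4) $\mu_x(\{x\})=0$ for all $x\in\mathbb E$. (B1) There is a stationary distribution $\nu$ of $X$ on $\mathbb E$ (fixed throughout). (B2) $\int_{\mathbb E}\lambda\,d\nu<\infty$. (B3) $\lambda$ is continuous. (B4) For Borel $A\subseteq\mathbb E$ and $x\in\mathbb E$, $\mu_{\varphi(x,h)}(A)\to\mu_x(A)$ as $h\to0$. (B5) $\mu_x(\partial_h\Gamma)\to0$ as $h\to0$ uniformly in $x\in\Gamma$. **Boundary measure.** $\sigma$ is the finite measure on $\Gamma$ with $\sigma(B)=E_\nu(N_t^+(B))/t$ for every $t>0$ and Borel $B\subseteq\Gamma$. It is known that $\|\xi\|$ is finite and strictly positive. *)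

(* Defs.v *)
From HB Require Import structures.
From mathcomp Require Import all_boot all_order all_algebra.
From mathcomp Require Import all_classical all_reals all_analysis.
From mathcomp Require Import measurable_realfun.

Set Implicit Arguments.
Unset Strict Implicit.
Unset Printing Implicit Defensive.

Import Order.TTheory GRing.Theory Num.Theory.
Import numFieldNormedType.Exports.

Local Open Scope classical_set_scope.
Local Open Scope ring_scope.

(* The subset D of T as a measurable space, with the Borel sigma-algebra of the
   relative topology.  D itself need not be Borel in T.  The point x0 is there
   only because the library's measurable types are pointed. *)
Definition borel_on (T : topologicalType) (D : set T) (x0 : D) : Type := D.

Section borel_on.
Variables (T : topologicalType) (D : set T) (x0 : D).

HB.instance Definition _ := Choice.copy (borel_on x0) (set_type D).
HB.instance Definition _ := isPointed.Build (borel_on x0) x0.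

Let opens : set (set (borel_on x0)) := @open (set_type D).

HB.instance Definition _ := @isMeasurable.Build (sigma_display opens)
  (borel_on x0) <<s opens >> (@sigma_algebra0 _ setT opens)
  (@sigma_algebraC (borel_on x0) opens) (@sigma_algebra_bigcup _ setT opens).

End borel_on.

Definition boundary (T : topologicalType) (A : set T) : set T :=
  closure A `\` A°.

(* c is the solution of c' = f(c), c(0) = x, followed in both time directions
   until it leaves the open set U: its lifetime in U is ]a, b[, and it does not
   explode, in the sense that a finite end of the lifetime is the time at which
   c reaches, continuously, a boundary point of U.  Beyond such an end c is kept
   constant; this convention makes c total without creating visits to new
   points.  The derivative is taken coordinatewise. *)
Definition is_trajectory (R : realType) (n : nat) (U : set 'rV[R]_n)
    (f : 'rV[R]_n -> 'rV[R]_n) (x : 'rV[R]_n) (c : R -> 'rV[R]_n) : Prop :=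
  exists a b : \bar R,
  [/\ (a < 0)%E, (0 < b)%E & c 0 = x] /\
  [/\ forall t : R, (a < t%:E)%E -> (t%:E < b)%E ->
        U (c t) /\
        forall j, is_derive t (1 : R) (fun s => c s 0 j) (f (c t) 0 j),
      forall u : R, b = u%:E ->
        [/\ boundary U (c u), c s @[s --> u^'-] --> c u &
            forall t, u <= t -> c t = c u] &
      forall u : R, a = u%:E ->
        [/\ boundary U (c u), c s @[s --> u^'+] --> c u &
            forall t, t <= u -> c t = c u]].

(* The deterministic part: the modes, the open sets E_i°, the vector fields r_i
   and the flows phi_i.  The values of r_i outside E_i° are irrelevant. *)
Record flow_system (R : realType) := FlowSystem {
  mode_count : nat;
  mode_dim : 'I_mode_count -> nat;
  mode_dom : forall i, set 'rV[R]_(mode_dim i);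
  vfield : forall i, 'rV[R]_(mode_dim i) -> 'rV[R]_(mode_dim i);
  phi : forall i, 'rV[R]_(mode_dim i) -> R -> 'rV[R]_(mode_dim i);
  dom_open : forall i, open (@mode_dom i);
  vfield_lipschitz : forall i, [locally [lipschitz (@vfield i) x | x in @mode_dom i]];
  phi_trajectory : forall i x, @mode_dom i x ->
    is_trajectory (@mode_dom i) (@vfield i) x (@phi i x);
  (* The case of interest is that of a boundary point phi_i(y,-s) at which the
     trajectory of y enters E_i°: it says that the flow started at an entrance
     point is well defined, and is what it is by continuity.  When phi_i(y,-s)
     lies in E_i° it is the usual flow property. *)
  phi_entrance : forall i y (s : R), @mode_dom i y -> 0 < s ->
    (forall u : R, - s < u -> u <= 0 -> @mode_dom i (phi y u)) ->
    forall t : R, 0 <= t -> phi (phi y (- s)) t = phi y (t - s);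
  base : {i & 'rV[R]_(mode_dim i)};
  base_dom : @mode_dom (tag base) (tagged base)
}.

Section spaces.
Variables (R : realType) (S : flow_system R).

(* the disjoint union of the Euclidean spaces, with the sum topology *)
Definition ambient : topologicalType :=
  {i : 'I_(mode_count S) & 'rV[R]_(mode_dim i)}.

Definition flow (x : ambient) (t : R) : ambient :=
  existT _ (tag x) (phi (tagged x) t).

Definition Eint : set ambient := [set x | mode_dom (tagged x)].

Definition Gamma : set ambient :=
  [set z | boundary (@mode_dom _ S (tag z)) (tagged z) /\
     exists x t, [/\ mode_dom x, 0 < t & tagged z = phi x t]].

Definition Gamma_star : set ambient :=
  [set z | boundary (@mode_dom _ S (tag z)) (tagged z) /\
     exists x t, [/\ mode_dom x, 0 < t & tagged z = phi x (- t)]].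

Definition E : set ambient := Eint `|` Gamma_star.
Definition Estar : set ambient := Eint `|` Gamma.

Lemma base_E : (base S : ambient) \in E.
Proof. by apply/mem_set; left; exact: base_dom. Qed.

Lemma base_Estar : (base S : ambient) \in Estar.
Proof. by apply/mem_set; left; exact: base_dom. Qed.

Lemma base_EGamma : (base S : ambient) \in E `|` Gamma.
Proof. by apply/mem_set; left; left; exact: base_dom. Qed.

Definition state : measurableType _ :=
  @borel_on ambient E (exist _ (base S) base_E).
Definition costate : measurableType _ :=
  @borel_on ambient Estar (exist _ (base S) base_Estar).
Definition prejump : measurableType _ :=
  @borel_on ambient (E `|` Gamma) (exist _ (base S) base_EGamma).

(* tau(x, B) *)
Definition hitting_time (x : ambient) (B : set ambient) : \bar R :=
  ereal_inf [set t%:E | t in [set t : R | 0 <= t /\ B (flow x t)]].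

Definition exit_time (x : ambient) : \bar R := hitting_time x Gamma.

(* the set written \partial_h Gamma *)
Definition near_Gamma (h : R) : set state :=
  [set x : state | (exit_time (sval x) < h%:E)%E].

End spaces.

(* lam and mu are functions on the ambient space; only the values of lam on E,
   and those of mu on E and Gamma, are relevant. *)
Record jump_mechanism (R : realType) (S : flow_system R) := JumpMechanism {
  lam : ambient S -> R;
  mu : ambient S -> probability (state S) R;
  lam_measurable : measurable_fun [set: state S] (fun x : state S => lam (sval x));
  lam_ge0 : forall x : state S, 0 <= lam (sval x);
  mu_measurable : forall B : set (state S), measurable B ->
    measurable_fun [set: prejump S] (fun x : prejump S => mu (sval x) B)
}.

Section survival.
Variables (R : realType) (S : flow_system R) (J : jump_mechanism S).

Definition hazard (x : ambient S) (D : set R) : \bar R :=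
  (\int[lebesgue_measure]_(u in D) (lam J (flow x u))%:E)%E.

Definition survival (x : ambient S) (t : R) : \bar R :=
  if (t%:E < exit_time x)%E then expeR (- hazard x `[0%R, t])%E else 0%E.

End survival.

(* A realization of the PDMP, as a Markov family (P_x), x in E, on one sample
   space.  jump_time n is T_n, with T_0 = 0; post n is Q_n, where Q_0 is the
   starting point; pre n is W_n, for n >= 1 only. *)
Record pdmp (R : realType) (S : flow_system R) (J : jump_mechanism S)
    (d : measure_display) (Omega : measurableType d) := Pdmp {
  Px : R.-pker (state S) ~> Omega;
  traj : R -> {mfun Omega >-> state S};
  jump_time : nat -> {mfun Omega >-> R};
  post : nat -> {mfun Omega >-> state S};
  pre : nat -> {mfun Omega >-> costate S};
  jump_time0 : forall w, jump_time 0 w = 0;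
  jump_time1_ge0 : forall w, 0 <= jump_time 1 w;
  jump_time_lt : forall n w, jump_time n.+1 w < jump_time n.+2 w;
  (* for n >= 1 this gives Q_n = X_(T_n), by taking t = T_n *)
  traj_flow : forall n w (t : R), jump_time n w <= t -> t < jump_time n.+1 w ->
    sval (traj t w) = flow (sval (post n w)) (t - jump_time n w);
  (* W_n = X_(T_n -) *)
  pre_left_limit : forall n w, jump_time n w < jump_time n.+1 w ->
    sval (traj t w) @[t --> (jump_time n.+1 w)^'-] --> sval (pre n.+1 w);
  (* T_1 = 0 happens when X starts at a point x of E that also lies in Gamma;
     then X_(T_1 -) is read as phi(x, T_1) = x *)
  pre_immediate : forall w, jump_time 1 w = 0 -> Gamma (sval (post 0 w)) ->
    sval (pre 1 w) = sval (post 0 w);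
  start : forall x, Px x (post 0 @^-1` [set x]) = 1%E;
  first_time_law : forall x (t : R), 0 <= t ->
    Px x [set w | t < jump_time 1 w] = survival J (sval x) t;
  first_jump_law : forall x (C : set R) (B : set (state S)),
    measurable C -> measurable B ->
    Px x (jump_time 1 @^-1` C `&` post 1 @^-1` B) =
    (\int[Px x]_(w in jump_time 1 @^-1` C)
       mu J (flow (sval x) (jump_time 1 w)) B)%E;
  (* after T_n the process restarts from Q_n: conditionally on T_0, Q_0, ...,
     T_n, Q_n, the pair (T_(n+1) - T_n, Q_(n+1)) is distributed as (T_1, Q_1)
     under P_(Q_n) *)
  restart : forall x n (G : set Omega) (C : set R) (B : set (state S)),
    <<s [set A | exists2 j, (j <= n)%N &
           (exists2 D, measurable D & A = jump_time j @^-1` D) \/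
           (exists2 D, measurable D & A = post j @^-1` D)] >> G ->
    measurable C -> measurable B ->
    Px x (G `&` [set w | C (jump_time n.+1 w - jump_time n w)]
            `&` post n.+1 @^-1` B) =
    (\int[Px x]_(w in G)
       Px (post n w) (jump_time 1 @^-1` C `&` post 1 @^-1` B))%E
}.

Section main_notions.
Variables (R : realType) (S : flow_system R) (J : jump_mechanism S).
Variables (d : measure_display) (Omega : measurableType d).
Variable X : pdmp J Omega.
Local Open Scope ereal_scope.

Definition jump_count (t : R) (w : Omega) : \bar R :=
  \sum_(0 <= n <oo) (\1_[set v | (jump_time X n.+1 v <= t)%R] w)%:E.

(* N_t^+(B), for B included in Gamma *)
Definition forced_jump_count (B : set (costate S)) (t : R) (w : Omega) : \bar R :=
  \sum_(0 <= n <oo)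
    (\1_[set v | (jump_time X n.+1 v <= t)%R /\ B (pre X n.+1 v)] w)%:E.

Definition stationary_distribution (nu : probability (state S) R) : Prop :=
  forall t : R, (0 <= t)%R -> forall A : set (state S), measurable A ->
    \int[nu]_x Px X x (traj X t @^-1` A) = nu A.

Record standing_assumptions (nu : probability (state S) R) : Prop := {
  A1 : forall x : state S, exists2 eps : R, (0 < eps)%R &
         hazard J (sval x) `[0%R, eps] < +oo;
  A2 : forall x : state S, exit_time (sval x) = +oo ->
         hazard J (sval x) `[0%R, +oo[ = +oo;
  A3 : forall (x : state S) (t : R), (0 < t)%R ->
         \int[Px X x]_w jump_count t w < +oo;
  A4 : forall x : state S, mu J (sval x) [set x] = 0;
  B1 : stationary_distribution nu;
  B2 : \int[nu]_x (lam J (sval x))%:E < +oo;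
  B3 : {within @E R S, continuous (lam J)};
  (* one-sided, since phi(x,h) with x in E only makes sense for h >= 0 when x is
     an entrance point *)
  B4 : forall (A : set (state S)) (x : state S), measurable A ->
         mu J (flow (sval x) h) A @[h --> (0 : R)^'+] --> mu J (sval x) A;
  B5 : forall eps : R, (0 < eps)%R -> exists2 h0 : R, (0 < h0)%R &
         forall h : R, (0 < h)%R -> (h < h0)%R -> forall x, @Gamma R S x ->
           mu J x (@near_Gamma R S h) < eps%:E
}.

(* Gamma as a subset of E* *)
Definition Gamma_in : set (costate S) := [set w | Gamma (sval w)].

(* The measure sigma on Gamma is represented on the larger space E*, as Gamma may
   be empty while measurable types are pointed.  Its values on subsets of E* that
   are not included in Gamma are unconstrained, and never used. *)
Definition boundary_measure (nu : probability (state S) R)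
    (sigma : {finite_measure set (costate S) -> \bar R}) : Prop :=
  forall (t : R) (B : set (costate S)), (0 < t)%R -> measurable B ->
    B `<=` Gamma_in ->
    sigma B =
      (\int[nu]_x \int[Px X x]_w forced_jump_count B t w) * (t^-1)%:E.

Definition xi_norm (nu : probability (state S) R)
    (sigma : {finite_measure set (costate S) -> \bar R}) : \bar R :=
  \int[nu]_x (lam J (sval x))%:E + sigma Gamma_in.

Definition is_pi (nu : probability (state S) R)
    (sigma : {finite_measure set (costate S) -> \bar R})
    (pi : probability (costate S * state S)%type R) : Prop :=
  forall (A : set (costate S)) (B : set (state S)),
    measurable A -> measurable B ->
    pi (A `*` B) = ((fine (xi_norm nu sigma))^-1)%:E *
      (\int[nu]_(x in [set x : state S | exists2 a, A a & sval a = sval x])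
          ((lam J (sval x))%:E * mu J (sval x) B) +
       \int[sigma]_(a in A `&` Gamma_in) mu J (sval a) B).

(* Z_n = (W_n, Q_n) *)
Definition Z (n : nat) (w : Omega) : costate S * state S :=
  (pre X n w, post X n w).

(* The transition kernel of (Z_n), n >= 1: by the restart property, given
   Z_n = (w,q) the next pair is distributed as Z_1 under P_q. *)
Definition Z_kernel (z : costate S * state S) (C : set (costate S * state S)) :
    \bar R :=
  Px X z.2 (Z 1 @^-1` C).

Definition stationary_for_Z (pi : probability (costate S * state S)%type R) :
    Prop :=
  forall C : set (costate S * state S), measurable C ->
    \int[pi]_z Z_kernel z C = pi C.

End main_notions.

(* Main.v *)
Require Import Defs.
From HB Require Import structures.
From mathcomp Require Import all_boot all_order all_algebra.
From mathcomp Require Import all_classical all_reals all_analysis.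
From mathcomp Require Import measurable_realfun.
From mathcomp Require Import lra.

Set Implicit Arguments.
Unset Strict Implicit.
Unset Printing Implicit Defensive.

Import Order.TTheory GRing.Theory Num.Theory.
Import numFieldNormedType.Exports.

Local Open Scope classical_set_scope.
Local Open Scope ring_scope.

(** Let M be the law of the process started from nu (M is [mixture nu (Px X)]
    below), and let xi_t(C) be the expected number, under M, of jumps with
    T_n <= t and Z_n in C ([jump_intensity]).  The proof has two halves.

    Campbell's formula ([jump_intensity_rectE]) says that, for every t > 0, xi_t
    is t times the unnormalized pi:
      xi_t(A x B) = t (\int_A lam(x) mu_x(B) nu(dx)
                       + \int_(A /\ Gamma) mu_x(B) sigma(dx)).
    Given T_n and W_n, the point Q_n has law mu at W_n
    ([first_jump_pre], [jump_intensity_rect]), so only the positions W_n matter.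
    The forced ones are counted by t sigma, which is how sigma is defined.  For
    the others, before its exit time T_1 has the density lam times survival
    probability along the flow ([T1_density]).  Hence the expectation of g(W_1)
    over an unforced first jump is the expectation of the integral of
    lam(X_s) g(X_s) over s < T_1 ([first_free_jump]).  Apply this to
    every interjump interval by the restart property ([restart_law]) and add up:
    the intervals [T_n, T_(n+1)[ tile [0, t] because the process does not
    explode ([no_explosion]), so the sum is the expectation of the integral of
    lam(X_r) g(X_r) over [0, t], which is t times the integral of lam g with
    respect to nu, as nu is stationary ([integral_free_intensity]).

    Therefore xi_t = t |xi| pi for all t > 0, with the probability pi equal to
    xi_1 normalized ([embedded_law]).  Now let K be the transition kernel of
    (Z_n).  By the restart property, the integral of K(z, C) over xi_t counts
    the n >= 1 with T_n <= t and Z_(n+1) in C, whereas xi_t(C) counts the n >= 1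
    with T_n <= t and Z_n in C.  The two counts differ by at most 1: by the first
    jump on one side, and by the jump that follows the last T_n <= t on the
    other ([integral_Z_kernel_upper], [integral_Z_kernel_lower]).  So
    t |xi| times the difference between the integral of K(z, C) over pi and
    pi(C) is bounded by 1 for all t, and the difference vanishes.

    The technical part is measurability.  E, E* and their union with Gamma need
    not be Borel sets, and neither the flow nor Gamma is assumed to be
    measurable in any sense.  Measurability comes from the process: the set of
    q with tau(q) > r and phi(q, r) in B is the set of q for which T_1 > r and
    X_r in B has a positive probability under P_q ([measurable_alive]). *)

(** * Joint laws and kernels *)

Section product_measures.
Context d1 d2 (T1 : measurableType d1) (T2 : measurableType d2) (R : realType).
Local Open Scope ereal_scope.

Lemma eq_measure_prod (m1 m2 : {measure set (T1 * T2) -> \bar R}) :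
  m1 setT < +oo ->
  (forall A B, measurable A -> measurable B -> m1 (A `*` B) = m2 (A `*` B)) ->
  forall C, measurable C -> m1 C = m2 C.
Proof.
move=> m1oo m12 C mC.
apply: (measure_unique
  [set A `*` B | A in measurable & B in measurable] (fun=> setT)) => //.
- by rewrite measurable_prod_measurableType.
- move=> _ _ [A1 mA1 [B1 mB1 <-]] [A2 mA2 [B2 mB2 <-]].
  exists (A1 `&` A2); first exact: measurableI.
  by exists (B1 `&` B2); [exact: measurableI|rewrite setXI].
- by move=> n; exists setT => //; exists setT => //; rewrite setXTT.
- by rewrite bigcup_const //; exists point.
- by move=> _ [A mA [B mB <-]]; exact: m12.
Qed.

End product_measures.

Section kernel_precomposition.
Context d1 d2 d3 (X : measurableType d1) (Y : measurableType d2)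
  (Z : measurableType d3) (R : realType).
Variables (k : R.-pker Y ~> Z) (f : {mfun X >-> Y}).
Local Open Scope ereal_scope.

Definition kpre (x : X) : {measure set Z -> \bar R} := k (f x).

Let measurable_kpre U : measurable U -> measurable_fun [set: X] (kpre ^~ U).
Proof. by move=> mU; exact: measurableT_comp (measurable_kernel k _ mU) _. Qed.

HB.instance Definition _ := isKernel.Build _ _ X Z R kpre measurable_kpre.

Let kpreT x : kpre x setT = 1.
Proof. exact: prob_kernel. Qed.

HB.instance Definition _ := Kernel_isProbability.Build _ _ X Z R kpre kpreT.

End kernel_precomposition.

Section constant_kernel.
Context d1 d2 (X : measurableType d1) (Y : measurableType d2) (R : realType).
Variable M : probability Y R.

Definition kcst (_ : X) : {measure set Y -> \bar R} := M.

Let measurable_kcst U : measurable U -> measurable_fun [set: X] (kcst ^~ U).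
Proof. by move=> mU; exact: measurable_cst. Qed.

HB.instance Definition _ := isKernel.Build _ _ X Y R kcst measurable_kcst.

Let kcstT x : kcst x setT = 1%E.
Proof. exact: probability_setT. Qed.

HB.instance Definition _ := Kernel_isProbability.Build _ _ X Y R kcst kcstT.

End constant_kernel.

Section graph_kernel.
Context d1 d2 (Y : measurableType d1) (Z : measurableType d2) (R : realType).
Variable k : R.-pker Y ~> Z.
Local Open Scope ereal_scope.

(** The kernel that maps y to the law of (y, z), z having law k y.  The factor
    unit in its source is the form that the composition of kernels asks for. *)
Definition kgraph (p : unit * Y) (D : set (Y * Z)) : \bar R :=
  k p.2 (xsection D p.2).

Let kgraph0 p : kgraph p set0 = 0.
Proof. by rewrite /kgraph xsection0 measure0. Qed.

Let kgraph_ge0 p D : 0 <= kgraph p D.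
Proof. exact: measure_ge0. Qed.

Let kgraph_sigma_additive p : semi_sigma_additive (kgraph p).
Proof.
move=> F mF tF mUF; rewrite /kgraph xsection_bigcup.
apply: measure_semi_sigma_additive.
- by move=> n; exact: measurable_xsection.
- exact: trivIset_xsection.
- by apply: bigcup_measurable => n _; exact: measurable_xsection.
Qed.

HB.instance Definition _ p := isMeasure.Build _ _ R (kgraph p)
  (kgraph0 p) (kgraph_ge0 p) (@kgraph_sigma_additive p).

Definition mkgraph : unit * Y -> {measure set (Y * Z) -> \bar R} := kgraph.

Let measurable_kgraph D : measurable D ->
  measurable_fun [set: unit * Y] (mkgraph ^~ D).
Proof.
move=> mD; rewrite [mkgraph ^~ D](_ : _ =
  (fun y => k y (xsection D y)) \o snd)//.
apply: measurableT_comp => //.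
by apply: measurable_fun_xsection_finite_kernel; exact/mem_set.
Qed.

HB.instance Definition _ := isKernel.Build _ _ (unit * Y)%type (Y * Z)%type R
  mkgraph measurable_kgraph.

Let kgraphT p : mkgraph p setT = 1.
Proof. by rewrite /mkgraph/= /kgraph xsectionE preimage_setT prob_kernel. Qed.

HB.instance Definition _ := Kernel_isProbability.Build _ _ (unit * Y)%type
  (Y * Z)%type R mkgraph kgraphT.

Lemma integral_kgraph p (F : Y * Z -> \bar R) :
  (forall p, 0 <= F p) -> measurable_fun setT F ->
  \int[kgraph p]_q F q = \int[k p.2]_z F (p.2, z).
Proof.
move=> F0 mF.
rewrite (_ : kgraph p = pushforward (k p.2) (pair p.2)); last first.
  by apply/funext => D; rewrite /kgraph xsectionE.
by rewrite ge0_integral_pushforward// preimage_setT.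
Qed.

End graph_kernel.

Section semidirect_product.
Context d1 d2 (Y : measurableType d1) (Z : measurableType d2) (R : realType).
Variables (M : probability Y R) (k : R.-pker Y ~> Z).
Local Open Scope ereal_scope.

(** The joint law of (y, z) when y has law M and, given y, z has law k y. *)
Definition sdprod : set (Y * Z) -> \bar R :=
  mkcomp (@kcst _ _ unit _ R M) (mkgraph k) tt.

HB.instance Definition _ := Measure.on sdprod.

Lemma sdprodE D : sdprod D = \int[M]_y k y (xsection D y).
Proof. by []. Qed.

Let sdprodT : sdprod setT = 1.
Proof.
rewrite sdprodE.
under eq_integral do rewrite xsectionE preimage_setT prob_kernel.
by rewrite integral_cst//= mul1e probability_setT.
Qed.

HB.instance Definition _ := Measure_isProbability.Build _ _ _ sdprod sdprodT.

Lemma integral_sdprod (F : Y * Z -> \bar R) :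
  (forall p, 0 <= F p) -> measurable_fun setT F ->
  \int[sdprod]_p F p = \int[M]_y \int[k y]_z F (y, z).
Proof.
move=> F0 mF; rewrite /sdprod integral_kcomp//.
by apply: eq_integral => y _; rewrite integral_kgraph.
Qed.

End semidirect_product.

(** * Relative topologies and the geometry of the flow *)

Section borel_trace.
Variables (T : topologicalType) (D : set T) (x0 : D).

(** The Borel sets of the relative topology are the traces of the Borel sets of
    the ambient space, although D is not assumed to be one of them. *)
Lemma borel_onP (A : set (borel_on x0)) :
  measurable A <->
  exists2 B, <<s @open T>> B & A = (fun x : borel_on x0 => B (sval x)).
Proof.
split.
- move: A; apply: smallest_sub.
  + split.
    * exists set0 => //; exact: sigma_algebra0.
    * move=> _ [B mB ->]; exists (~` B); first by rewrite -setTD; exact: sigma_algebraCD.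
      by rewrite setTD.
    * move=> F /= FP.
      have /choice[G GP] : forall n, exists B, <<s @open T>> B /\
          F n = (fun x : borel_on x0 => B (sval x)).
        by move=> n; have [B] := FP n; exists B.
      exists (\bigcup_n G n).
        by apply: sigma_algebra_bigcup => n; have [] := GP n.
      apply/seteqP; split=> x.
        by move=> [n _]; have [_ ->] := GP n => Gx; exists n.
      by move=> [n _ Gx]; exists n => //; have [_ ->] := GP n.
  + move=> U [V oV VU]; exists V; first exact: sub_sigma_algebra.
    by rewrite -VU.
- move=> [B mB ->]; move: B mB; apply: smallest_sub.
  + split.
    * exact: measurable0.
    * move=> B mB; rewrite setTD.
      exact: (@measurableC _ (borel_on x0) (fun x => B (sval x))).
    * move=> F mF.
      rewrite (_ : (fun x : borel_on x0 => _) =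
        \bigcup_n (fun x : borel_on x0 => F n (sval x)))//.
      exact: bigcupT_measurable.
  + move=> U oU; apply: sub_sigma_algebra; exists U => //.
Qed.

End borel_trace.

Section continuity.
Variables (R : realType).

Lemma cvg_coord (n : nat) (c : R -> 'rV[R]_n) (F : set_system R)
    (FF : Filter F) (l : 'rV[R]_n) :
  (forall j, c s 0 j @[s --> F] --> l 0 j) -> c s @[s --> F] --> l.
Proof.
move=> cl; apply/cvg_ballP => e e0.
suff : \forall s \near F, forall j, ball (l 0 j) e (c s 0 j).
  by apply: filterS => s h; split => // i j; rewrite ord1.
apply: filter_forall => j.
have /cvg_ballP := cl j; exact.
Qed.

(** Differentiability gives continuity inside the lifetime; at its two ends the
    one-sided limit on the inside meets the constant extension on the outside. *)
Lemma traj_continuous (n : nat) (U : set 'rV[R]_n) f x c :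
  is_trajectory U f x c -> continuous c.
Proof.
move=> [a [b [[a0 b0 cx] [cU cb ca]]]] t.
have [ta|ta] := ltP t%:E a.
  move: ca a0 ta; case: a {cU} => // u /(_ u erefl)[_ _ cu] _.
  rewrite lte_fin => tu; rewrite /continuous_at (cu t (ltW tu)).
  apply: cvg_near_cst; near=> s; apply: cu; apply/ltW; near: s.
  exact: lt_nbhsl.
have [bt|bt] := ltP b t%:E.
  move: cb b0 bt; case: b {cU} => // u /(_ u erefl)[_ _ cu] _.
  rewrite lte_fin => ut; rewrite /continuous_at (cu t (ltW ut)).
  apply: cvg_near_cst; near=> s; apply: cu; apply/ltW; near: s.
  exact: lt_nbhsr.
move: ta; rewrite le_eqVlt => /predU1P[ta|ta].
  have [_ ct cu] := ca _ ta.
  apply/left_right_continuousP; split => //.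
  by apply: cvg_near_cst; near=> s; exact: cu.
move: bt; rewrite le_eqVlt => /predU1P[tb|tb].
  have [_ ct cu] := cb _ (esym tb).
  apply/left_right_continuousP; split => //.
  by apply: cvg_near_cst; near=> s; exact: cu.
have [_ ct] := cU _ ta tb.
apply: cvg_coord => j; have [dt _] := ct j.
exact: (differentiable_continuous (proj1 (derivable1_diffP _ _) dt)).
Unshelve. all: by end_near. Qed.

End continuity.

Section flow_geometry.
Variables (R : realType) (S : flow_system R).

Lemma open_boundary_disj (T : topologicalType) (U : set T) z :
  open U -> U z -> ~ boundary U z.
Proof. by rewrite openE => oU /oU zU [_]. Qed.

Lemma Eint_Gamma_disj (z : ambient S) : Eint z -> ~ Gamma z.
Proof.
by move=> zU [zb _]; exact: (open_boundary_disj (@dom_open R S (tag z)) zU).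
Qed.

Lemma ambient_hausdorff : hausdorff_space (ambient S).
Proof. by apply: sigT_hausdorff => i; exact: norm_hausdorff. Qed.

(** From a point of E° the lifetime is that of its trajectory.  An entrance point
    is phi(x, u), where u < 0 is the backward lifetime of an interior point x;
    by [phi_entrance] its path is that of x shifted by u, which turns the
    lifetime b of x into b - u. *)
Lemma flow_life (q : ambient S) : E q ->
  exists (e : \bar R) (c : R -> ambient S),
    [/\ (0 < e)%E, continuous c, c 0 = q &
     [/\ forall t, 0 <= t -> flow q t = c t,
         forall t, 0 < t -> (t%:E < e)%E -> Eint (flow q t) &
         forall t, (e <= t%:E)%E -> Gamma (flow q t)]].
Proof.
move=> [qU|[qb [x [t [xU t0 qx]]]]].
- have := phi_trajectory qU => /[dup] tr [a [b [[a0 b0 cx] [cU cb ca]]]].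
  exists b, (flow q); split => //.
  + move=> t; apply: (@continuous_comp _ _ _ (phi (tagged q)) (existT _ (tag q))).
      exact: traj_continuous tr _.
    exact: existT_continuous.
  + by rewrite /flow cx; case: (q).
  split => //.
  + by move=> t t0 tb; apply: (cU _ _ tb).1; rewrite (lt_trans a0).
  + move=> t; move: cb b0; case: b {cU} => // u /(_ u erefl)[bu _ cu] u0.
    rewrite lee_fin => ut; split => /=; rewrite cu//.
    by exists (tagged q), u.
- case: q qb x xU qx => i q /= qb x xU qx.
  have := phi_trajectory xU => /[dup] tr [a [b [[a0 b0 cx] [cU cb ca]]]].
  have at_ : (- t%:E <= a)%E.
    rewrite leNgt; apply/negP => at_.
    have tb : ((- t)%:E < b)%E by rewrite (lt_trans _ b0)// lte_fin oppr_lt0.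
    have [] := cU _ at_ tb; rewrite -qx => qU _.
    exact: (open_boundary_disj (@dom_open R S i) qU).
  case: a a0 at_ cU ca => // u; rewrite lte_fin -EFinN lee_fin => u0 tu cU ca.
  have {ca} [ub ut cu] := ca _ erefl.
  have {tu}qx : q = phi x (- - u) by rewrite opprK qx cu.
  have ent (v : R) : 0 <= v -> phi q v = phi x (v - - u).
    rewrite qx; apply: phi_entrance => //; first by rewrite oppr_gt0.
    move=> w; rewrite opprK => uw w0.
    by apply: (cU _ _ _).1; rewrite ?lte_fin// (le_lt_trans _ b0)// lee_fin.
  exists (b - u%:E)%E, (fun v => existT _ i (phi x (v + u))); split.
  + by rewrite sube_gt0 (lt_trans _ b0).
  + move=> v.
    apply: (@continuous_comp _ _ _ (fun v => phi x (v + u)) (existT _ i)).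
      apply: (@continuous_comp _ _ _ (fun v => v + u) (phi x)).
        by apply: cvgD; [exact: cvg_id|exact: cvg_cst].
      exact: traj_continuous tr _.
    exact: existT_continuous.
  + by rewrite add0r qx opprK.
  split.
  + by move=> v v0; rewrite /flow /= ent// opprK.
  + move=> v v0 vb; rewrite /Eint/= ent 1?ltW// opprK.
    apply: (cU _ _ _).1; first by rewrite lte_fin ltrDr.
    by rewrite EFinD -lteBrDr.
  + move: cb b0 cU; case: b => [w|_ _ _ v|]; [|by rewrite leye_eq|by []].
      move=> /(_ w erefl)[bu _ cw] w0 cU v.
      rewrite -EFinB lee_fin lerBlDr => wv.
      have v0 : 0 <= v.
        rewrite lte_fin in w0.
        by lra.
      split => /=; rewrite (ent _ v0) opprK (cw _ wv); first exact: bu.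
      by exists x, w.
Qed.

End flow_geometry.

(** * Densities and Lebesgue measure on the line *)

Section density_measure.
Context d (T : measurableType d) (R : realType).
Variables (mu : {measure set T -> \bar R}) (f : T -> R).
Hypotheses (mf : measurable_fun setT f) (f0 : forall x, 0 <= f x).
Local Open Scope ereal_scope.

Definition mdensity (_ : measurable_fun setT f) (_ : forall x, (0 <= f x)%R)
  (A : set T) : \bar R := \int[mu]_(x in A) (f x)%:E.
Local Notation m := (mdensity mf f0).

Let mdensity0 : m set0 = 0.
Proof. by rewrite /mdensity integral_set0. Qed.

Let mdensity_ge0 A : 0 <= m A.
Proof. by apply: integral_ge0 => x _; rewrite lee_fin. Qed.

Let mdensity_sigma_additive : semi_sigma_additive m.
Proof.
move=> F mF tF mUF; rewrite /mdensity.
rewrite ge0_integral_bigcup//; last 2 first.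
  - exact/measurable_EFinP/measurable_funTS.
  - by move=> x _; rewrite lee_fin.
by apply: is_cvg_nneseries => n _ _; exact: mdensity_ge0.
Qed.

HB.instance Definition _ := isMeasure.Build _ _ R m
  mdensity0 mdensity_ge0 mdensity_sigma_additive.

Import HBNNSimple.

Let integral_mdensity_nnsfun (h : {nnsfun T >-> R}) :
  \int[m]_x (h x)%:E = \int[mu]_x ((h x)%:E * (f x)%:E).
Proof.
under [LHS]eq_integral do rewrite fimfunE -fsumEFin//.
rewrite ge0_integral_fsum//; last 2 first.
  - by move=> r; exact/measurable_EFinP/measurableT_comp.
  - by move=> r z _; rewrite EFinM nnfun_muleindic_ge0.
under [RHS]eq_integral.
  move=> x _; rewrite fimfunE -fsumEFin// ge0_mule_fsuml; last first.
    by move=> r; rewrite EFinM nnfun_muleindic_ge0.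
  over.
rewrite ge0_integral_fsum//; last 2 first.
  - move=> r; apply: emeasurable_funM; last exact/measurable_EFinP.
    exact/measurable_EFinP/measurableT_comp.
  - move=> r x _; apply: mule_ge0; last by rewrite lee_fin.
    by rewrite EFinM nnfun_muleindic_ge0.
apply: eq_fsbigr => r _.
rewrite integralZl_indic_nnsfun//= integral_indic// setIT.
under [RHS]eq_integral do rewrite EFinM -muleA.
have [r0|r0] := ltP r 0%R.
  rewrite preimage_nnfun0// measure0 mule0 integral0_eq// => x _.
  by rewrite indic0 mul0e mule0.
rewrite ge0_integralZl//; last 2 first.
  - apply: emeasurable_funM; last exact/measurable_EFinP.
    exact/measurable_EFinP/measurable_indic.
  - by move=> x _; rewrite mule_ge0// lee_fin.
congr (_ * _); rewrite [LHS]/= /mdensity [LHS]integral_mkcond.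
by apply: eq_integral => x _; rewrite epatch_indic /= muleC.
Qed.

Lemma integral_mdensity (k : T -> \bar R) :
  measurable_fun setT k -> (forall x, 0 <= k x) ->
  \int[m]_x k x = \int[mu]_x (k x * (f x)%:E).
Proof.
move=> mk k0; pose k_ := nnsfun_approx measurableT mk.
transitivity (lim (\int[m]_x (k_ n x)%:E @[n --> \oo])).
  rewrite -monotone_convergence//=.
  - apply: eq_integral => x _; apply/esym/cvg_lim => //=.
    exact: cvg_nnsfun_approx.
  - by move=> n; exact/measurable_EFinP/measurable_funTS.
  - by move=> n ? _; rewrite lee_fin.
  - by move=> ? _ ? ? mn; rewrite lee_fin; exact/lefP/nd_nnsfun_approx.
under eq_fun do rewrite integral_mdensity_nnsfun.
rewrite -monotone_convergence//=.
- apply: eq_integral => x _; apply/cvg_lim => //=.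
  apply: cvgeZr => //.
  exact: cvg_nnsfun_approx.
- move=> n; apply: emeasurable_funM; last exact/measurable_EFinP.
  exact/measurable_EFinP/measurable_funTS.
- by move=> n x _; rewrite mule_ge0// lee_fin.
- move=> x _ i j ij; apply: lee_wpmul2r; first by rewrite lee_fin.
  by rewrite lee_fin; exact/lefP/nd_nnsfun_approx.
Qed.

End density_measure.

Section lebesgue_on_R.
Variable R : realType.
Local Open Scope ereal_scope.

(** Lebesgue measure on the measurable space R, rather than on its copy
    measurableTypeR R: products with R and laws of real random variables are
    built on R itself. *)
Definition lebR : set R -> \bar R := @lebesgue_measure R.

HB.instance Definition _ := isMeasure.Build _ R R lebR
  (measure0 (@lebesgue_measure R)) (measure_ge0 (@lebesgue_measure R))
  (@measure_semi_sigma_additive _ _ _ (@lebesgue_measure R)).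

Let lebR_sigma_finite : sigma_finite setT lebR.
Proof. exact: (@sigma_finiteT _ _ _ (@lebesgue_measure R)). Qed.

HB.instance Definition _ := Measure_isSigmaFinite.Build _ R R lebR
  lebR_sigma_finite.

Lemma integral_lebR (D : set R) (f : R -> \bar R) :
  measurable D -> measurable_fun D f -> (forall x, D x -> 0 <= f x) ->
  \int[lebR]_(x in D) f x = \int[lebesgue_measure]_(x in D) f x.
Proof.
move=> mD mf f0; pose idR : measurableTypeR R -> R := idfun.
have midR : measurable_fun setT idR by exact: (@measurable_id _ _ setT).
rewrite -[RHS](@ge0_integral_pushforward _ _ (measurableTypeR R) R R idR midR
  (@lebesgue_measure R))//.
by move=> x /set_mem; exact: f0.
Qed.

End lebesgue_on_R.
Arguments lebR {R}.

Section lebesgue_translation.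
Context {R : realType}.
Local Notation mu := (@lebesgue_measure R).
Local Open Scope ereal_scope.

Lemma lebesgue_measure_shift (c : R) (A : set R) : measurable A ->
  pushforward mu (fun r : measurableTypeR R => (r - c)%R : measurableTypeR R) A = mu A.
Proof.
move=> mA; apply/esym/lebesgue_measure_unique => //=.
  exact: measurable_funB.
move=> mS _ [[a b]] _ <-.
rewrite /= /pushforward (_ : _ @^-1` _ = `](a + c)%R, (b + c)%R]%classic); last first.
  by apply/seteqP; split => x/=; rewrite !in_itv/= ltrBrDr lerBlDr.
rewrite !lebesgue_measure_itv/= !lte_fin ltrD2r.
by case: ifPn => // _; rewrite -!EFinB opprD addrACA subrr addr0.
Qed.

Lemma ge0_integral_shift (c : R) (f : R -> \bar R) :
  measurable_fun setT f -> (forall x, 0 <= f x) ->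
  \int[lebR]_x f (x - c)%R = \int[lebR]_x f x.
Proof.
move=> mf f0; rewrite !integral_lebR//; last first.
  by apply: measurableT_comp => //; exact: measurable_funB.
transitivity (\int[pushforward mu (fun r : measurableTypeR R => (r - c)%R : measurableTypeR R)]_x f x).
  by rewrite ge0_integral_pushforward//; exact: measurable_funB.
apply: eq_measure_integral; first exact: measurable_funB.
by move=> mS A mA _; exact: lebesgue_measure_shift.
Qed.

(** The fundamental theorem of calculus for - exp(- \int_0^x g): a waiting time
    with hazard rate g has density g(x) exp(- \int_0^x g). *)
Lemma integral_exp_hazard (g : R -> R) (u : R) : (0 < u)%R -> continuous g ->
  \int[mu]_(x in `[0%R, u])
     (g x * expR (- \int[mu]_(t in `[0%R, x]) g t))%:E =
  (1 - expR (- \int[mu]_(t in `[0%R, u]) g t))%:E.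
Proof.
move=> u0 cg.
pose L (x : R) := (\int[mu]_(t in `[0%R, x]) g t)%R.
have ig (v : R) : mu.-integrable `[0%R, v] (EFin \o g).
  apply: continuous_compact_integrable; first exact: segment_compact.
  exact: continuous_subspaceT.
have Lu := parameterized_integral_continuous (ltW u0) (ig u).
have [Lin L0 L1] := (continuous_within_itvP L u0).1 Lu.
have Ld x : (0 < x)%R -> derivable L x 1 /\ L^`()%classic x = g x.
  move=> x0; have x1 : (x < x + 1)%R by rewrite ltrDl.
  by apply: (@continuous_FTC1 _ g (BLeft 0%R) x _ x1 (ig _)) => //; exact: cg.
have EL : continuous (fun y => expR (- y) : R).
  move=> y; apply: continuous_comp; first exact: opp_continuous.
  exact: continuous_expR.
rewrite (@continuous_FTC2 _ _ (fun x => - expR (- L x))%R)//.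
- rewrite -EFinB; congr EFin.
  have -> : L 0%R = 0%R by rewrite /L set_itv1 Rintegral_set1.
  by rewrite oppr0 expR0 opprK addrC.
- move=> x; apply: cvgM.
    exact: (continuous_subspaceT cg).
  exact: (@continuous_comp (subspace `[0%R, u]) _ _ L (fun y => expR (- y)) x
    (Lu x) (EL _)).
- split.
  + move=> x; rewrite in_itv/= => /andP[x0 _].
    apply/derivableN/derivable1_diffP/differentiable_comp.
      exact/derivable1_diffP/derivableN/(Ld _ x0).1.
    exact/derivable1_diffP/derivable_expR.
  + apply: cvgN; exact: (cvg_comp L (fun y => expR (- y)) L0 (EL _)).
  + apply: cvgN; exact: (cvg_comp L (fun y => expR (- y)) L1 (EL _)).
- move=> x; rewrite in_itv/= => /andP[x0 _].
  have [dL <-] := Ld _ x0.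
  rewrite (@derive1N _ (expR \o (- L)%R)); last first.
    apply/derivable1_diffP/differentiable_comp.
      exact/derivable1_diffP/derivableN.
    exact/derivable1_diffP/derivable_expR.
  rewrite derive1_comp; [|exact: derivableN|exact: derivable_expR].
  rewrite derive1N// mulrN opprK mulrC; congr (_ * _)%R.
  by rewrite derive1E derive_val.
Qed.

End lebesgue_translation.

(** * The exit time and the first jump *)

Lemma ae_iff_measure d (T : measurableType d) (R : realType)
    (m : {measure set T -> \bar R}) (A B : set T) :
  measurable A -> measurable B -> {ae m, forall w, A w <-> B w} -> m A = m B.
Proof.
move=> mA mB AB; rewrite -[A]setIT -[B]setIT -!integral_indic//.
apply: ge0_ae_eq_integral => //.
- exact/measurable_EFinP/measurable_indic.
- exact/measurable_EFinP/measurable_indic.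
move: AB; apply: filterS => w AB _; rewrite !indicE; congr (_%:R%:E).
by congr nat_of_bool; apply: asbool_equiv_eq.
Qed.

Lemma ae_measure1 d (T : measurableType d) (R : realType)
    (m : {measure set T -> \bar R}) (A : set T) :
  measurable A -> m setT = 1%E -> m A = 1%E -> {ae m, forall w, A w}.
Proof.
move=> mA mT1 mA1; exists (~` A); split => //; first exact: measurableC.
rewrite -setTD measureD//; last by rewrite [ltLHS]mT1 ltry.
rewrite setTI; transitivity (1 - 1 : \bar R)%E; last by rewrite subee.
by congr (_ - _)%E.
Qed.

Section exit_time.
Variables (R : realType) (S : flow_system R).
Local Open Scope ereal_scope.

Lemma exit_time_ge0 (q : ambient S) : 0 <= exit_time q.
Proof. by apply: le_ereal_inf_tmp => _ [t [t0 _] <-]; rewrite lee_fin. Qed.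

Lemma exit_time_le (q : ambient S) (t : R) : (0 <= t)%R -> Gamma (flow q t) ->
  exit_time q <= t%:E.
Proof. by move=> t0 Gt; apply: ereal_inf_lbound; exists t. Qed.

Lemma flow0 (q : ambient S) : E q -> flow q 0 = q.
Proof. by move=> /flow_life[e [c [_ _ c0 [ft _ _]]]]; rewrite ft. Qed.

Lemma exit_time_Gamma (q : ambient S) : E q -> Gamma q -> exit_time q = 0.
Proof.
move=> Eq Gq; apply/eqP; rewrite eq_le exit_time_ge0 andbT.
by apply: exit_time_le => //; rewrite flow0.
Qed.

(** The exit time is the lifetime of the path except on Gamma, where it is 0: a
    point of E may be both an entrance and an exit point. *)
Lemma exit_time_lifetime (q : ambient S) (e : \bar R) : E q -> ~ Gamma q ->
  0 < e ->
  (forall t : R, (0 < t)%R -> t%:E < e -> Eint (flow q t)) ->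
  (forall t : R, e <= t%:E -> Gamma (flow q t)) ->
  exit_time q = e.
Proof.
move=> Eq nGq e0 fE fG; apply/eqP; rewrite eq_le; apply/andP; split.
  case: e e0 fE fG => [u| |]//; last by rewrite leey.
  rewrite lte_fin => u0 _ fG; apply: exit_time_le; first exact: ltW.
  exact: fG.
apply: le_ereal_inf_tmp => _ [t [t0 Gt] <-]; rewrite leNgt; apply/negP => te.
move: t0; rewrite le_eqVlt => /predU1P[t0|t0].
  by apply: nGq; rewrite -(flow0 Eq) t0.
exact: Eint_Gamma_disj (fE _ t0 te) Gt.
Qed.

(** [flow_life] in terms of the exit time: stated in this way it holds for all
    points of E, those of Gamma included. *)
Lemma flow_exit (q : ambient S) : E q -> exists2 c : R -> ambient S,
  continuous c &
  [/\ forall t : R, (0 <= t)%R -> flow q t = c t,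
      forall t : R, (0 < t)%R -> t%:E < exit_time q -> Eint (flow q t) &
      forall t : R, exit_time q = t%:E -> Gamma (flow q t)].
Proof.
move=> Eq; have [e [c [e0 cc c0 [fc fE fG]]]] := flow_life Eq.
exists c => //; split => //.
  move=> t t0 tx; apply: fE => //; rewrite ltNge; apply/negP => et.
  move: tx; rewrite ltNge => /negP; apply.
  by apply: exit_time_le; [exact: ltW|exact: fG].
have [Gq|nGq] := pselect (Gamma q).
  by move=> t; rewrite exit_time_Gamma// => -[<-]; rewrite flow0.
by move=> t; rewrite (exit_time_lifetime Eq nGq e0 fE fG) => et; apply: fG; rewrite et.
Qed.

Lemma flow_in_E (q : ambient S) (t : R) : E q -> (0 <= t)%R ->
  t%:E < exit_time q -> E (flow q t).
Proof.
move=> Eq; rewrite le_eqVlt => /predU1P[<-|t0] tx; first by rewrite flow0.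
by have [c _ [_ fE _]] := flow_exit Eq; left; exact: fE.
Qed.

Lemma flow_EGamma (q : ambient S) (t : R) : E q -> (0 <= t)%R ->
  t%:E <= exit_time q -> (@E R S `|` @Gamma R S) (flow q t).
Proof.
move=> Eq t0; rewrite le_eqVlt => /predU1P[tx|tx]; last by left; exact: flow_in_E.
by have [c _ [_ _ fG]] := flow_exit Eq; right; exact: fG.
Qed.

Lemma exit_time_gt0 (q : ambient S) : E q -> ~ Gamma q -> 0 < exit_time q.
Proof.
move=> Eq nGq; have [e [c [e0 cc c0 [fc fE fG]]]] := flow_life Eq.
by rewrite (exit_time_lifetime Eq nGq e0 fE fG).
Qed.

End exit_time.

Section borel_events.
Variables (T : topologicalType) (D : set T) (x0 : D).

Lemma measurable_sval (B : set T) : <<s @open T>> B ->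
  measurable (fun x : borel_on x0 => B (sval x)).
Proof. by move=> mB; apply/borel_onP; exists B. Qed.

Lemma borel_on_measurable1 (x : borel_on x0) :
  hausdorff_space T -> measurable [set x].
Proof.
move=> hT; rewrite (_ : [set x] = (fun y : borel_on x0 => [set sval x] (sval y))).
  apply: measurable_sval; rewrite -[X in <<s _ >> X]setCK -setTD.
  apply: sigma_algebraCD; apply: sub_sigma_algebra; apply: closed_openC.
  exact: accessible_closed_set1 (hausdorff_accessible hT) _.
apply/seteqP; split => [y ->//|y /= yx]; exact/val_inj.
Qed.

End borel_events.

Section first_jump.
Variables (R : realType) (S : flow_system R) (J : jump_mechanism S).
Variables (d : measure_display) (Omega : measurableType d).
Variable X : pdmp J Omega.
Local Open Scope ereal_scope.

Let T1 := jump_time X 1.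

Lemma state_E (q : state S) : E (sval q).
Proof. by case: q => x xE; apply/set_mem. Qed.

Lemma PxT (q : state S) : Px X q setT = 1.
Proof. exact: prob_kernel. Qed.

Lemma start_ae (q : state S) : {ae Px X q, forall w, post X 0 w = q}.
Proof.
have mq : measurable (post X 0 @^-1` [set q]).
  apply: measurable_funPTI.
  exact: borel_on_measurable1 (ambient_hausdorff (S := S)).
exact: (ae_measure1 mq (PxT q) (start X q)).
Qed.

Lemma measurable_T1_gt (r : R) : measurable [set w | (r < T1 w)%R].
Proof.
rewrite (_ : [set _ | _] = T1 @^-1` `]r, +oo[%classic); last first.
  by apply/seteqP; split => w /=; rewrite in_itv/= andbT.
exact: measurable_funPTI.
Qed.

Lemma measurable_traj (r : R) (B : set (ambient S)) : <<s @open (ambient S)>> B ->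
  measurable [set w | B (sval (traj X r w))].
Proof.
move=> mB.
have mB' : measurable ((fun x => B (sval x)) : set (state S)).
  exact: measurable_sval.
exact: (measurable_funPTI (traj X r) mB').
Qed.

Lemma traj_first w (r : R) : (0 <= r)%R -> (r < T1 w)%R ->
  sval (traj X r w) = flow (sval (post X 0 w)) r.
Proof.
move=> r0 rT; rewrite -[in RHS](subr0 r) -(jump_time0 X w).
by apply: traj_flow => //; rewrite jump_time0.
Qed.

End first_jump.

Section survival_law.
Variables (R : realType) (S : flow_system R) (J : jump_mechanism S).
Variables (d : measure_display) (Omega : measurableType d).
Variable X : pdmp J Omega.
Hypothesis lamc : {within @E R S, continuous (lam J)}.
Local Notation leb := (@lebesgue_measure R).

Lemma lam_ge0E (x : ambient S) : E x -> 0 <= lam J x.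
Proof. by move=> Ex; exact: (lam_ge0 J (exist _ x (mem_set Ex))). Qed.

(** Up to u the path stays in E, on which lam is continuous.  Clamping the time
    to [0, u] extends the intensity to a continuous function on the line, as the
    fundamental theorem of calculus requires. *)
Lemma lam_path (q : ambient S) (u : R) :
  E q -> 0 <= u -> (u%:E < exit_time q)%E -> exists g : R -> R,
  [/\ continuous g, forall s, 0 <= g s &
      forall s, 0 <= s -> s <= u -> g s = lam J (flow q s)].
Proof.
move=> Eq u0 ux; have [c cc [fc _ _]] := flow_exit Eq.
pose clamp (s : R) := Num.max 0 (Num.min s u).
have clamp_ge0 s : 0 <= clamp s by rewrite /clamp le_max lexx.
have clamp_le s : clamp s <= u by rewrite /clamp ge_max u0 ge_min lexx orbT.
have cE s : E (c (clamp s)).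
  rewrite -fc//; apply: flow_in_E => //.
  by rewrite (le_lt_trans _ ux)// lee_fin.
exists (fun s => lam J (c (clamp s))); split.
- have cclamp : continuous clamp.
    move=> s; apply: (@continuous_max R R (cst 0) (id \min cst u)).
      exact: cvg_cst.
    by apply: (@continuous_min R R id (cst u)); [exact: cvg_id|exact: cvg_cst].
  move=> s V /= Vs.
  have /subspace_continuousP /(_ _ (cE s) V Vs) := lamc.
  rewrite /= nbhs_simpl /= => nV.
  have := cc (clamp s) _ nV.
  move=> /cclamp; rewrite !nbhs_simpl /=; apply: filterS => t /= h.
  exact: h (cE t).
- by move=> s; exact: lam_ge0E.
- move=> s s0 su; rewrite fc//; congr (lam J (c _)).
  by rewrite /clamp (min_idPl su) (max_idPr s0).
Qed.

Lemma survival_expR (q : ambient S) (u : R) (g : R -> R) :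
  (u%:E < exit_time q)%E -> continuous g ->
  (forall s, 0 <= s -> s <= u -> g s = lam J (flow q s)) ->
  forall r, 0 <= r -> r <= u ->
  survival J q r = (expR (- \int[leb]_(t in `[0, r]) g t)%R)%:E.
Proof.
move=> ux cg gE r r0 ru; rewrite /survival (le_lt_trans _ ux) ?lee_fin//.
have -> : hazard J q `[0, r] = (\int[leb]_(t in `[0, r]) g t)%R%:E.
  rewrite /Rintegral fineK; last first.
    apply: integrable_fin_num => //.
    apply: continuous_compact_integrable; first exact: segment_compact.
    exact: continuous_subspaceT.
  apply: eq_integral => t; rewrite inE/= in_itv/= => /andP[t0 tr].
  by rewrite gE// (le_trans tr).
by [].
Qed.

Lemma survival_gt0 (q : ambient S) (r : R) :
  E q -> 0 <= r -> (r%:E < exit_time q)%E -> (0 < survival J q r)%E.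
Proof.
move=> Eq r0 rx; have [g [cg _ gE]] := lam_path Eq r0 rx.
by rewrite (survival_expR rx cg gE)// lte_fin expR_gt0.
Qed.

Lemma survival_eq0 (q : ambient S) (r : R) :
  (exit_time q <= r%:E)%E -> survival J q r = 0%E.
Proof. by rewrite /survival ltNge => ->. Qed.

Local Notation T1 := (jump_time X 1).
Local Open Scope ereal_scope.

(** The intensity is bounded on compact pieces of the path, so the process
    survives with a positive probability at any time before the exit time. *)
Lemma T1_gt_exit (q : state S) (r : R) : (0 <= r)%R ->
  (0 < Px X q [set w | (r < T1 w)%R]) = (r%:E < exit_time (sval q)).
Proof.
move=> r0; rewrite first_time_law//; apply/idP/idP.
  by rewrite [in X in _ -> X]ltNge; apply: contraTN => /survival_eq0 ->; rewrite ltxx.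
by move=> rx; exact: (survival_gt0 (state_E q)).
Qed.

Lemma T1_le_exit (q : state S) :
  {ae Px X q, forall w, (T1 w)%:E <= exit_time (sval q)}.
Proof.
have := exit_time_ge0 (sval q); have := T1_gt_exit q.
case: (exit_time (sval q)) => [r| |//] qr r0; last by apply: aeW => w; rewrite leey.
exists [set w | (r < T1 w)%R]; split.
- exact: measurable_T1_gt.
- by apply/eqP; rewrite -measure_le0 leNgt qr// ltxx.
- by move=> w /=; rewrite lee_fin => /negP; rewrite -ltNge.
Qed.

Lemma T1_gt0 (q : state S) : ~ Gamma (sval q) ->
  {ae Px X q, forall w, (0 < T1 w)%R}.
Proof.
move=> nG; apply: (ae_measure1 (measurable_T1_gt X 0) (PxT X q)).
rewrite first_time_law//.
have x0 := exit_time_gt0 (state_E q) nG.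
have [g [cg _ gE]] := lam_path (state_E q) (lexx _) x0.
by rewrite (survival_expR x0 cg gE)// set_itv1 Rintegral_set1 oppr0 expR0.
Qed.

(** W_(n+1) is the left limit of a path that coincides with the flow from Q_n on
    the whole interval between the jumps, and the flow is continuous. *)
Lemma pre_flow n w : (jump_time X n w < jump_time X n.+1 w)%R ->
  sval (pre X n.+1 w) =
  flow (sval (post X n w)) (jump_time X n.+1 w - jump_time X n w).
Proof.
move=> TT; have [c cc [fc _ _]] := flow_exit (state_E (post X n w)).
have Wl := pre_left_limit TT.
apply: (cvg_unique (@ambient_hausdorff R S) Wl).
have D0 : (0 <= jump_time X n.+1 w - jump_time X n w)%R by rewrite subr_ge0 ltW.
rewrite fc//.
have cl : c (t - jump_time X n w)%R @[t --> (jump_time X n.+1 w)^'-] -->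
    c (jump_time X n.+1 w - jump_time X n w)%R.
  apply: cvg_at_left_filter.
  apply: (@continuous_comp _ _ _ (fun t => t - jump_time X n w)%R c); last exact: cc.
  by apply: cvgB; [exact: cvg_id|exact: cvg_cst].
apply: cvg_trans cl; apply: near_eq_cvg; near=> t.
have Tt : (jump_time X n w <= t)%R.
  by near: t; apply: nbhs_left_ge.
rewrite (traj_flow Tt) ?fc ?subr_ge0//.
Unshelve. all: by end_near. Qed.

(** When X starts on Gamma, T_1 = 0 may occur and no left limit exists; then
    [pre_immediate] takes over.  Elsewhere T_1 > 0 almost surely. *)
Lemma pre1_flow (q : state S) :
  {ae Px X q, forall w, sval (pre X 1 w) = flow (sval q) (T1 w)}.
Proof.
have G0 : {ae Px X q, forall w, ~ Gamma (sval q) -> (0 < T1 w)%R}.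
  have [Gq|nGq] := pselect (Gamma (sval q)); first by apply: aeW.
  by apply: filterS (T1_gt0 nGq) => w.
apply: filterS2 (start_ae X q) G0 => w w0 wG.
have := jump_time1_ge0 X w; rewrite le_eqVlt => /predU1P[T0|T0].
  have Gq : Gamma (sval q).
    by apply: contrapT => /wG; rewrite -T0 ltxx.
  by rewrite -T0 flow0; [rewrite pre_immediate ?w0|exact: state_E].
by rewrite pre_flow jump_time0 ?subr0 ?w0.
Qed.

End survival_law.

(** * Measurability of the flow *)

Section closed_exhaustion.
Variables (R : realType) (S : flow_system R).

(** The points at distance at least 1 / (m + 1) from the complement of U. *)
Definition inner (U : set (ambient S)) (m : nat) : set (ambient S) :=
  [set z | ball (tagged z) m.+1%:R^-1 `<=` existT _ (tag z) @^-1` U].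

Lemma inner_subset U m : inner U m `<=` U.
Proof.
by move=> [i x]; apply => /=; apply: ballxx; rewrite invr_gt0.
Qed.

Lemma inner_near U z : open U -> U z -> exists m, \forall z' \near z, inner U m z'.
Proof.
case: z => i x /sigT_openP /(_ i) oU Ux.
have /nbhs_ballP[e /= e0 eU] : nbhs x (existT _ i @^-1` U).
  exact: open_nbhs_nbhs.
have [m me] : exists m, (m.+1%:R^-1 < e / 2 :> R).
  have e2 : 0 < e / 2 by rewrite divr_gt0.
  exists (Num.truncn (e / 2)^-1); rewrite invf_plt ?posrE//.
  by apply: truncnS_gt; rewrite num_real.
exists m.
suff : \forall y \near x, inner U m (existT _ i y) by [].
near=> y => y' /= yy'; apply: eU.
rewrite (splitr e); apply: (@ball_triangle _ _ y).
  near: y; apply: nbhsx_ballx; exact: divr_gt0.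
by apply: le_ball yy'; exact: ltW.
Unshelve. all: by end_near. Qed.

Lemma open_innerC U m : open (~` inner U m).
Proof.
apply/sigT_openP => i.
rewrite (_ : _ @^-1` _ = \bigcup_(y in ~` (existT _ i @^-1` U))
    ball (y : 'rV[R]_(mode_dim i)) (m.+1%:R^-1 : R)).
  by apply: bigcup_open => y _; exact: ball_open.
apply/seteqP; split => x /=.
  rewrite /inner /= => /existsNP[y /not_implyP[xy nUy]].
  by exists y => //; exact: ball_sym.
by move=> [y nUy yx] /(_ y (ball_sym yx)).
Qed.

Lemma borel_inner U m : <<s @open (ambient S)>> (inner U m).
Proof.
rewrite -[inner U m]setCK -setTD; apply: sigma_algebraCD.
by apply: sub_sigma_algebra; exact: open_innerC.
Qed.

(** An open set is the union of the closed sets [inner U m], and each of its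
    points is interior to one of them.  So a continuous path is in U at time s
    exactly when it stays in one [inner U m] at the rational times just before
    s: this replaces the value at s by countably many values at times r < s, at
    which the flow has not yet reached the boundary. *)
Lemma path_open_rat (U : set (ambient S)) (c : R -> ambient S) (s : R) :
  open U -> continuous c -> 0 < s ->
  U (c s) <-> exists m, exists2 p : rat, ratr p < s &
    forall r : rat, ratr p < ratr r :> R -> 0 <= ratr r :> R -> ratr r < s ->
      inner U m (c (ratr r)).
Proof.
move=> oU cc s0; split.
  move=> /(inner_near oU)[m /cc /nbhs_ballP[e /= e0 ec]].
  have /rat_in_itvoo[p] : s - e < s by rewrite ltrBlDr ltrDl.
  rewrite in_itv/= => /andP[ep ps]; exists m, p => // r pr r0 rs.
  apply: ec; rewrite /ball/= ger0_norm ?subr_ge0 ?ltW//.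
  by rewrite ltrBlDr -ltrBlDl (lt_trans ep).
move=> [m [p ps h]]; apply: (@inner_subset _ m); apply: contrapT => nI.
have := @open_innerC U m; rewrite openE => /(_ _ nI)/cc/nbhs_ballP[e /= e0 ec].
have : Num.max (s - e) (Num.max (ratr p) 0) < s.
  by rewrite !gt_max ltrBlDr ltrDl e0 ps s0.
move=> /rat_in_itvoo[r]; rewrite in_itv/= !gt_max => /andP[/and3P[er pr r0] rs].
apply: (ec (ratr r)) (h r pr (ltW r0) rs).
rewrite /ball/= ger0_norm ?subr_ge0 ?ltW//.
by rewrite ltrBlDr -ltrBlDl.
Qed.

End closed_exhaustion.

Section measurability.
Variables (R : realType) (S : flow_system R) (J : jump_mechanism S).
Variables (d : measure_display) (Omega : measurableType d).
Variable X : pdmp J Omega.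
Hypothesis lamc : {within @E R S, continuous (lam J)}.
Local Notation T1 := (jump_time X 1).
Local Notation borel := (<<s @open (ambient S)>>).
Local Open Scope ereal_scope.

(** The conditions on q say that P_q charges the event that T_1 > r and that X_r
    is in B, and P_q is a kernel. *)
Lemma measurable_alive (r : R) (B : set (ambient S)) : (0 <= r)%R -> borel B ->
  measurable ([set q : state S |
    r%:E < exit_time (sval q) /\ B (flow (sval q) r)]).
Proof.
move=> r0 mB.
pose U := [set w | (r < T1 w)%R] `&` [set w | B (sval (traj X r w))].
have mU : measurable U.
  by apply: measurableI; [exact: measurable_T1_gt|exact: measurable_traj].
have PU (q : state S) : B (flow (sval q) r) ->
    Px X q U = Px X q [set w | (r < T1 w)%R].
  move=> Bq; apply: ae_iff_measure => //; first exact: measurable_T1_gt.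
  apply: filterS (start_ae X q) => w w0; split=> [[]//|rT]; split => //=.
  by rewrite traj_first// w0.
have PU0 (q : state S) : ~ B (flow (sval q) r) -> Px X q U = 0.
  move=> Bq; rewrite -(measure0 (Px X q)); apply: ae_iff_measure => //.
  apply: filterS (start_ae X q) => w w0; split => // -[/= rT].
  by rewrite traj_first// w0.
rewrite (_ : [set _ | _] = setT `&` [set q | 0 < Px X q U]); last first.
  apply/seteqP; split => q /=.
    by move=> [rx Bq]; split => //=; rewrite PU// (T1_gt_exit X lamc).
  move=> [_]; have [Bq|nBq] := pselect (B (flow (sval q) r)).
    by rewrite PU// (T1_gt_exit X lamc).
  by rewrite PU0// ltxx.
apply: emeasurable_fun_o_infty => //.
exact: (measurable_kernel (Px X)).
Qed.

Lemma borelT : borel setT.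
Proof. by apply: sub_sigma_algebra; exact: openT. Qed.

Lemma measurable_stateGamma : measurable [set q : state S | Gamma (sval q)].
Proof.
rewrite -[X in measurable X]setCK; apply: measurableC.
rewrite (_ : ~` _ = [set q : state S |
    0%:E < exit_time (sval q) /\ setT (flow (sval q) 0)]); last first.
  apply/seteqP; split => q /=.
    by move=> nG; split => //; exact: (exit_time_gt0 (state_E q)).
  by move=> [+ _]; apply: contraPnot => Gq; rewrite exit_time_Gamma ?ltxx//; exact: state_E.
exact: (measurable_alive (lexx _) borelT).
Qed.

Definition before_exit : set (state S * R) :=
  [set p | (0 <= p.2)%R /\ p.2%:E < exit_time (sval p.1)].
Definition upto_exit : set (state S * R) :=
  [set p | (0 <= p.2)%R /\ p.2%:E <= exit_time (sval p.1)].

Let alive (r : rat) (B : set (ambient S)) : set (state S) :=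
  [set q | [/\ (0 <= ratr r :> R)%R, (ratr r)%:E < exit_time (sval q) &
               B (flow (sval q) (ratr r))]].

Let measurable_alive_rat r B : borel B -> measurable (alive r B).
Proof.
move=> mB; have [r0|r0] := leP 0%R (ratr r : R).
  rewrite (_ : alive r B = [set q : state S |
    (ratr r)%:E < exit_time (sval q) /\ B (flow (sval q) (ratr r))]).
    exact: measurable_alive.
  by apply/seteqP; split=> [q []//|q []].
rewrite (_ : alive r B = set0)//.
by rewrite -subset0 => q [+ _ _]; rewrite leNgt r0.
Qed.

Let measurable_snd_set (A : set R) : measurable A ->
  measurable ([set p | A p.2] : set (state S * R)).
Proof. by move=> mA; rewrite -[X in measurable X]setTI; exact: measurable_snd. Qed.

Let measurable_fst_set (A : set (state S)) : measurable A ->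
  measurable ([set p | A p.1] : set (state S * R)).
Proof. by move=> mA; rewrite -[X in measurable X]setTI; exact: measurable_fst. Qed.

Lemma measurable_before_exit : measurable before_exit.
Proof.
rewrite (_ : before_exit = [set p | `[0%R, +oo[%classic p.2] `&`
    \bigcup_(r : rat) ([set p | `]-oo, (ratr r)[%classic p.2] `&`
                       [set p | alive r setT p.1])).
  apply: measurableI; first exact: measurable_snd_set.
  apply: bigcupT_measurable_rat => r; apply: measurableI.
    exact: measurable_snd_set.
  by apply: measurable_fst_set; apply: measurable_alive_rat; exact: borelT.
apply/seteqP; split => -[q s] /=.
  move=> [/= s0 sx]; rewrite in_itv/= s0; split => //.
  have [r /andP[sr rx]] : exists r : rat, (s < ratr r)%R && ((ratr r)%:E < exit_time (sval q)).
    move: sx; case: (exit_time (sval q)) => [u| |]//.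
      by rewrite lte_fin => /rat_in_itvoo[r]; rewrite in_itv/= => h; exists r.
    have /rat_in_itvoo[r] : (s < s + 1)%R by rewrite ltrDl.
    by rewrite in_itv/= => /andP[h _]; exists r; rewrite h ltry.
  exists r => //; split; first by rewrite /= in_itv/=.
  split => //=; by rewrite (le_trans s0)// ltW.
move=> [+ [r _ [+ [r0 rx _]]]]; rewrite !in_itv/= andbT => s0 sr; split => //=.
by rewrite (lt_trans _ rx).
Qed.

Lemma measurable_upto_exit : measurable upto_exit.
Proof.
rewrite (_ : upto_exit = [set p | `[0%R, +oo[%classic p.2] `\`
    \bigcup_(r : rat) (([set p | `]ratr r, +oo[%classic p.2] `&`
       [set p | (0 <= ratr r :> R)%R]) `\` [set p | alive r setT p.1])).
  apply: measurableD; first exact: measurable_snd_set.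
  apply: bigcupT_measurable_rat => r; apply: measurableD.
    apply: measurableI; first exact: measurable_snd_set.
    by case: (leP 0%R (ratr r : R)) => _; [rewrite (_ : [set _ | _] = setT)|rewrite (_ : [set _ | _] = set0)] => //; apply/seteqP; split.
  by apply: measurable_fst_set; apply: measurable_alive_rat; exact: borelT.
apply/seteqP; split => -[q s] /=.
  move=> [/= s0 sx]; split; first by rewrite /= in_itv/= s0.
  move=> [r _ [[/=]]].
  rewrite in_itv/= andbT => rs r0; apply; split => //.
  by rewrite (lt_le_trans _ sx).
move=> [/= + h]; rewrite in_itv/= andbT => s0; split => //=; rewrite leNgt; apply/negP => xs.
apply: h.
have [r [xr rs]] : exists r : rat, exit_time (sval q) < (ratr r)%:E /\ (ratr r < s)%R.
  have := exit_time_ge0 (sval q).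
  move: xs; case: (exit_time (sval q)) => [u| |]//.
  rewrite lte_fin => /rat_in_itvoo[r]; rewrite in_itv/= => /andP[ur rs] _.
  by exists r; rewrite lte_fin.
exists r => //; split; first split => //=; first by rewrite in_itv/= rs.
  by rewrite -lee_fin (le_trans (exit_time_ge0 _) (ltW xr)).
by move=> [_ + _]; rewrite ltNge (ltW xr).
Qed.

(** For B open, [path_open_rat] expresses the set through the sections at
    rational times, which [measurable_alive] handles.  Time 0 is treated apart,
    as it is not preceded by any rational time of the path. *)
Lemma measurable_flow (B : set (ambient S)) : borel B ->
  measurable (upto_exit `&` [set p | B (flow (sval p.1) p.2)]).
Proof.
move: B; apply: smallest_sub; first split.
- by rewrite (_ : _ `&` _ = set0)//; apply/seteqP; split => p // [].
- move=> B mB; rewrite setTD (_ : _ `&` _ = upto_exit `\`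
      (upto_exit `&` [set p | B (flow (sval p.1) p.2)])).
    by apply: measurableD => //; exact: measurable_upto_exit.
  apply/seteqP; split => p [Lp nB]; split => //=; first by move=> [_]; exact: nB.
  by move=> Bp; apply: nB.
- move=> F mF; rewrite (_ : _ `&` _ = \bigcup_k (upto_exit `&`
      [set p | F k (flow (sval p.1) p.2)])); first exact: bigcupT_measurable.
  apply/seteqP; split => p; first by move=> [Lp [k _ Fk]]; exists k.
  by move=> [k _ [Lp Fk]]; split => //; exists k.
- move=> U oU.
  have mU : borel U by exact: sub_sigma_algebra.
  (* Z and Pos separate the time 0 from the positive times; W m p is the event
     that the path is in inner U m at the rational times of ]p, s[, and p < s. *)
  pose Z : set (state S * R) := [set p | [set 0%R] p.2] `&` [set p | U (sval p.1)].
  pose Pos : set (state S * R) := [set p | `]0%R, +oo[%classic p.2].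
  pose W m (p : rat) := [set x : state S * R | `]ratr p, +oo[%classic x.2] `\`
     \bigcup_(r : rat) (([set x : state S * R | `]ratr r, +oo[%classic x.2] `&`
       [set x | (0 <= ratr r :> R)%R /\ (ratr p < ratr r :> R)%R])
       `\` [set x | alive r (inner U m) x.1]).
  have WE m p x : upto_exit x -> W m p x <-> (ratr p < x.2)%R /\
      forall r : rat, (ratr p < ratr r :> R)%R -> (0 <= ratr r :> R)%R -> (ratr r < x.2)%R ->
      inner U m (flow (sval x.1) (ratr r)).
    case: x => q s [/= s0 sx]; split.
      move=> [/=]; rewrite in_itv/= andbT => ps h; split => // r pr r0 rs.
      apply: contrapT => nI; apply: h; exists r => //; split.
        by rewrite /= in_itv/= rs.
      by move=> [_ _].
    move=> [ps h]; split; first by rewrite /= in_itv/= ps.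
    move=> [r _ [[/=]]]; rewrite in_itv/= andbT => rs [r0 pr]; apply; split => //.
      by rewrite (lt_le_trans _ sx).
    exact: h.
  rewrite (_ : _ `&` _ = (upto_exit `&` Z) `|`
    (upto_exit `&` (Pos `&` \bigcup_m \bigcup_(p : rat) W m p))).
    apply: measurableU; apply: measurableI; [exact: measurable_upto_exit| |exact: measurable_upto_exit|].
      apply: measurableI; first exact: measurable_snd_set.
      apply: (@measurable_fst_set (fun q : state S => U (sval q))).
      exact: measurable_sval.
    apply: measurableI; first exact: measurable_snd_set.
    apply: bigcupT_measurable => m; apply: bigcupT_measurable_rat => p.
    apply: measurableD; first exact: measurable_snd_set.
    apply: bigcupT_measurable_rat => r; apply: measurableD.
      apply: measurableI; first exact: measurable_snd_set.
      have [?|nrp] := pselect ((0 <= ratr r :> R)%R /\ (ratr p < ratr r :> R)%R).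
        by rewrite (_ : [set _ | _] = setT)//; apply/seteqP; split.
      by rewrite (_ : [set _ | _] = set0)//; apply/seteqP; split.
    by apply: measurable_fst_set; apply: measurable_alive_rat; exact: borel_inner.
  have key x : upto_exit x -> (0 < x.2)%R ->
      U (flow (sval x.1) x.2) <-> exists m p, W m p x.
    case: x => q s [/= s0 sx] sp.
    have [c cc [fc _ _]] := flow_exit (state_E q).
    rewrite fc// (path_open_rat oU cc sp); split => -[m].
      move=> [p ps h]; exists m, p; apply/WE => //; split => // r pr r0 rs /=.
      by rewrite fc//; exact: h.
    move=> [p /WE[]// ps h]; exists m, p => // r pr r0 rs.
    by rewrite -fc//; exact: h.
  apply/seteqP; split => [[q s] [Lp Up]|[q s] [[Lp [/= s0 Uq]]|[Lp [/= + [m _ [p _ Wp]]]]]].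
  + have := Lp.1; rewrite /= le_eqVlt => /predU1P[s0|sp].
      left; split => //; split => //=.
      by move: Up; rewrite /= -s0 flow0//; exact: state_E.
    right; split => //; split; first by rewrite /Pos/= in_itv/= sp.
    have [+ _] := key (q, s) Lp sp; move=> /(_ Up)[m [p Wp]].
    by exists m => //; exists p.
  + by split => //=; rewrite s0 flow0//; exact: state_E.
  + rewrite /Pos/= in_itv/= andbT => sp; split => //.
    by apply: (proj2 (key (q, s) Lp sp)); exists m, p.
Qed.

End measurability.

(** * The law of the first jump *)

Section measure_equality.
Local Open Scope ereal_scope.

Lemma eq_measure_cover d (T : measurableType d) (R : realType)
    (m1 m2 : {measure set T -> \bar R}) (D : (set T)^nat) :
  (forall n, measurable (D n)) ->
  (forall n A, measurable A -> A `<=` D n -> m1 A = m2 A) ->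
  forall A, measurable A -> A `<=` \bigcup_n D n -> m1 A = m2 A.
Proof.
move=> mD m12 A mA AD.
have mS n : measurable (A `&` seqDU D n).
  apply: measurableI => //; apply: measurableD => //.
  by apply: bigsetU_measurable => i _; exact: mD.
have AE : A = \bigcup_n (A `&` seqDU D n).
  by rewrite -setI_bigcupr -seqDU_bigcup_eq (setIidl AD).
have tS : trivIset setT (fun n => A `&` seqDU D n).
  exact/trivIset_setIl/trivIset_seqDU.
rewrite AE !measure_bigcup//.
apply: eq_eseriesr => n _; apply: (m12 n) => //.
by move=> x [_]; exact: subset_seqDU.
Qed.

(** Inside [0, u] the half-lines ]v, +oo[ generate the Borel sets, and their
    traces are the complements of the segments [0, v]. *)
Lemma eq_measure_segment (R : realType)
    (m1 m2 : {measure set R -> \bar R}) (u : R) : (0 <= u)%R ->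
  m1 `[0%R, u]%classic < +oo ->
  (forall v : R, (0 <= v <= u)%R -> m1 `[0%R, v]%classic = m2 `[0%R, v]%classic) ->
  forall A, measurable A -> A `<=` `[0%R, u]%classic -> m1 A = m2 A.
Proof.
move=> u0 m1oo m12 A mA Au.
have mI : measurable (`[0%R, u]%classic : set R) by exact: measurable_itv.
rewrite -(setIidl Au) -[LHS]/(mrestr m1 mI A) -[RHS]/(mrestr m2 mI A).
have h := @measure_unique _ R R (@RGenOInfty.G R) (fun n => `](- n%:R : R)%R, +oo[%classic).
apply: (h _ _ _ _ (mrestr m1 mI) (mrestr m2 mI)) => //; clear h.
- exact: RGenOInfty.measurableE.
- move=> _ _ [x ->] [y ->]; exists (Num.max x y); apply/seteqP; split => z /=.
    by rewrite !in_itv/= !andbT gt_max => -[-> ->].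
  by rewrite !in_itv/= !andbT gt_max => /andP[].
- by move=> n; exists (- n%:R)%R.
- apply/seteqP; split => // x _; exists (Num.truncn `|x|).+1 => //=.
  rewrite in_itv/= andbT ltrNl.
  by rewrite (le_lt_trans (ler_norm _))// normrN truncnS_gt.
- move=> _ [v ->]; rewrite /= /mrestr.
  have [v0|v0] := ltP v 0%R.
    rewrite setIidr; first by apply: m12; rewrite u0 lexx.
    by move=> x /=; rewrite !in_itv/= andbT => /andP[x0 _]; rewrite (lt_le_trans v0).
  have [vu|uv] := leP v u; last first.
    rewrite (_ : _ `&` _ = set0) ?measure0//.
    rewrite -subset0 => x [] /=; rewrite !in_itv/= andbT => vx /andP[_ xu].
    by move: (lt_trans (lt_le_trans vx xu) uv); rewrite ltxx.
  have -> : (`]v, +oo[ `&` `[0%R, u] = `[0%R, u] `\` `[0%R, v] :> set R)%classic.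
    apply/seteqP; split => x /=; rewrite !in_itv/= andbT.
      by move=> [vx /andP[-> ->]]; split => //; rewrite [X in _ && X]leNgt vx.
    by move=> [/andP[x0 xu] /negP]; rewrite x0/= xu -ltNge.
  have m2oo : m2 `[0%R, u]%classic < +oo by rewrite -m12// u0 lexx.
  have vuE : (`[0%R, u] `&` `[0%R, v] = `[0%R, v] :> set R)%classic.
    by apply/setIidr; apply: subset_itvl; rewrite bnd_simp.
  rewrite !measureD//= vuE m12 ?u0 ?lexx// m12// v0.
  by [].
- move=> n; rewrite /= /mrestr; apply: le_lt_trans m1oo; apply: le_measure => //.
    by rewrite inE; apply: measurableI.
  by rewrite inE.
Qed.

End measure_equality.

Section flow_functions.
Variables (R : realType) (S : flow_system R) (J : jump_mechanism S).
Variables (d : measure_display) (Omega : measurableType d).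
Variable X : pdmp J Omega.
Hypothesis lamc : {within @E R S, continuous (lam J)}.
Local Open Scope ereal_scope.

Lemma measurable_fun_flow (D : set (ambient S)) (x0 : D) d'
    (T : measurableType d') (f : ambient S -> T) (K : set (state S * R)) :
  measurable_fun [set: borel_on x0] (fun x => f (sval x)) ->
  measurable K -> K `<=` upto_exit (S := S) ->
  (forall p, K p -> D (flow (sval p.1) p.2)) ->
  measurable_fun K (fun p => f (flow (sval p.1) p.2)).
Proof.
move=> mf mK KL KD _ Y mY.
have := mf measurableT _ mY; rewrite setTI => /borel_onP[B mB fB].
rewrite (_ : _ `&` _ = K `&` (upto_exit (S := S) `&`
    [set p | B (flow (sval p.1) p.2)])).
  by apply: measurableI => //; exact: (measurable_flow X lamc).
have BE p : K p -> Y (f (flow (sval p.1) p.2)) <-> B (flow (sval p.1) p.2).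
  move=> Kp.
  pose x : borel_on x0 := exist (fun z => is_true (z \in D)) _ (mem_set (KD _ Kp)).
  by have /= -> := congr1 (@^~ x) fB.
apply/seteqP; split => p [Kp].
  by move=> Yp; split => //; split; [exact: KL|exact/(BE p Kp)].
by move=> [_ Bp]; split => //; exact/(BE p Kp).
Qed.

End flow_functions.

Section start_law.
Variables (R : realType) (S : flow_system R) (J : jump_mechanism S).
Variables (d : measure_display) (Omega : measurableType d).
Variable X : pdmp J Omega.

Definition law_from (q : state S) : set Omega -> \bar R := Px X q.

HB.instance Definition _ q := Measure.on (law_from q).

HB.instance Definition _ q :=
  Measure_isProbability.Build _ _ _ (law_from q) (PxT X q).

End start_law.

Section excursion.
Variables (R : realType) (S : flow_system R) (J : jump_mechanism S).
Variables (d : measure_display) (Omega : measurableType d).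
Variable X : pdmp J Omega.
Hypothesis lamc : {within @E R S, continuous (lam J)}.
Local Notation leb := (@lebesgue_measure R).
Local Notation T1 := (jump_time X 1).
Local Notation before_exit := (before_exit (S := S)).
Local Notation upto_exit := (upto_exit (S := S)).
Local Notation borel := (<<s @open (ambient S)>>).
Local Open Scope ereal_scope.

Lemma before_upto : before_exit `<=` upto_exit.
Proof. by move=> p [? /ltW]. Qed.

Definition flow_lam (p : state S * R) : R :=
  ((fun p => lam J (flow (sval p.1) p.2)) \_ before_exit) p.

Lemma flow_lam_ge0 p : (0 <= flow_lam p)%R.
Proof.
rewrite /flow_lam patchE; case: ifPn => // /set_mem[p0 px].
by apply: lam_ge0E; apply: flow_in_E => //; exact: state_E.
Qed.

Lemma measurable_flow_lam : measurable_fun setT flow_lam.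
Proof.
apply/(measurable_restrictT _ _).1; first exact: (measurable_before_exit X lamc).
apply: (measurable_fun_flow X lamc (x0 := exist _ (base S) (base_E S))).
- exact: lam_measurable.
- exact: (measurable_before_exit X lamc).
- exact: before_upto.
- by move=> p [p0 px]; apply: flow_in_E => //; exact: state_E.
Qed.

Definition survive (q : state S) (s : R) : R := fine (Px X q [set w | (s < T1 w)%R]).

Lemma surviveE q s : (survive q s)%:E = Px X q [set w | (s < T1 w)%R].
Proof.
by rewrite /survive fineK//; exact: (finite_kernel_measure (Px X) q (measurable_T1_gt X s)).
Qed.

Lemma survive_ge0 q s : (0 <= survive q s)%R.
Proof. by rewrite -lee_fin surviveE. Qed.

Lemma measurable_T1_after : measurable ([set p | p.1 < T1 p.2]%R : set (R * Omega)).
Proof.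
rewrite -[X in measurable X]setTI.
have := @measurable_fun_ltr _ (R * Omega)%type R setT fst (T1 \o snd).
move=> /(_ _ _ measurableT [set true]); apply => //.
exact: measurableT_comp.
Qed.

Lemma measurable_survive q : measurable_fun setT (survive q).
Proof.
apply/measurable_EFinP; rewrite (_ : EFin \o _ =
  (law_from X q \o xsection ([set p | p.1 < T1 p.2]%R : set (R * Omega)))).
  by apply: measurable_fun_xsection; exact: measurable_T1_after.
by apply/funext => s /=; rewrite surviveE xsectionE.
Qed.

Definition T1_pdf (q : state S) (s : R) : R := (flow_lam (q, s) * survive q s)%R.

Lemma T1_pdf_ge0 q s : (0 <= T1_pdf q s)%R.
Proof. by rewrite mulr_ge0// ?flow_lam_ge0// survive_ge0. Qed.

Lemma measurable_T1_pdf q : measurable_fun setT (T1_pdf q).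
Proof.
apply: measurable_funM; last exact: measurable_survive.
apply: (measurableT_comp measurable_flow_lam); exact: measurable_pair1.
Qed.

Definition T1_dens (q : state S) : {measure set R -> \bar R} :=
  mdensity lebR (measurable_T1_pdf q) (T1_pdf_ge0 q).

Definition lifetime (q : state S) : set R := xsection before_exit q.

Lemma lifetimeE q s : lifetime q s <-> (0 <= s)%R /\ s%:E < exit_time (sval q).
Proof. by rewrite /lifetime; split=> [/xsectionP|h]; [|apply/xsectionP]. Qed.

Lemma measurable_lifetime q : measurable (lifetime q).
Proof. by apply: measurable_xsection; exact: (measurable_before_exit X lamc). Qed.

Let T1_density_segment (q : state S) (u : R) :
  (0 <= u)%R -> u%:E < exit_time (sval q) ->
  forall A, measurable A -> A `<=` `[0%R, u]%classic ->
  distribution (law_from X q) T1 A =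
  T1_dens q A.
Proof.
move=> u0 ux; have [g [cg g0 gE]] := lam_path lamc (state_E q) u0 ux.
have sE := survival_expR ux cg gE.
apply: (@eq_measure_segment R (distribution (law_from X q) T1)
    (T1_dens q) u u0).
  by rewrite (le_lt_trans (probability_le1 _ _))// ltry.
move=> v /andP[v0 vu].
have P1 : distribution (law_from X q) T1 `[0%R, v]%classic =
    (1 - expR (- \int[leb]_(t in `[0%R, v]) g t)%R)%:E.
  rewrite /distribution/= /pushforward (_ : _ @^-1` _ = ~` [set w | (v < T1 w)%R]).
    rewrite probability_setC; last exact: measurable_T1_gt.
    by rewrite EFinB /law_from first_time_law// sE.
  apply/seteqP; split => w /=; rewrite in_itv/=; last first.
    by move=> /negP; rewrite -leNgt jump_time1_ge0.
  by move=> /andP[_]; rewrite leNgt => /negP.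
apply: (eq_trans P1); rewrite /T1_dens/= /mdensity.
rewrite integral_lebR//; last 2 first.
  - by apply/measurable_EFinP; apply: measurable_funTS; exact: measurable_T1_pdf.
  - by move=> s _; rewrite lee_fin T1_pdf_ge0.
move: v0; rewrite le_eqVlt => /predU1P[<-|v0].
  by rewrite set_itv1 Rintegral_set1 oppr0 expR0 subrr integral_set1.
rewrite -integral_exp_hazard//; apply: eq_integral => s; rewrite inE/= in_itv/=.
move=> /andP[s0 sv]; have su : (s <= u)%R by exact: le_trans vu.
congr EFin; rewrite /T1_pdf; congr (_ * _)%R.
  rewrite /flow_lam patchE mem_set ?gE//; split => //=.
  by rewrite (le_lt_trans _ ux)// lee_fin.
by apply: EFin_inj; rewrite surviveE first_time_law// sE.
Qed.

(** The law of T_1 may have an atom at the exit time, and only there: before it,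
    T_1 has a density.  The lifetime is exhausted by the segments [0, r], r
    rational, on which the two measures agree by [integral_exp_hazard]. *)
Lemma T1_density (q : state S) (A : set R) :
  measurable A -> A `<=` lifetime q ->
  distribution (law_from X q) T1 A =
  T1_dens q A.
Proof.
pose D (n : nat) : set R := if @unpickle rat n is Some r then
  if (0 <= ratr r :> R)%R && ((ratr r)%:E < exit_time (sval q))
  then `[0%R, ratr r]%classic else set0 else set0.
move=> mA AL; apply: (@eq_measure_cover _ _ R (distribution (law_from X q) T1)
  (T1_dens q) D).
- by move=> n; rewrite /D; case: unpickle => // r; case: ifP.
- move=> n B mB; rewrite /D; case: unpickle => [r|]; last first.
    by rewrite subset0 => ->; rewrite !measure0.
  case: ifPn => [/andP[r0 rx] Br|_]; first exact: (T1_density_segment r0 rx).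
  by rewrite subset0 => ->; rewrite !measure0.
- exact: mA.
- move=> s /AL/lifetimeE[s0 sx].
  have [r sr rx] : exists2 r : rat, (s < ratr r)%R & (ratr r)%:E < exit_time (sval q).
    move: sx; case: (exit_time (sval q)) => [u| |]//.
      by rewrite lte_fin => /rat_in_itvoo[r]; rewrite in_itv/= => /andP[h ?]; exists r.
    have /rat_in_itvoo[r] : (s < s + 1)%R by rewrite ltrDl.
    by rewrite in_itv/= => /andP[h _]; exists r; rewrite ?h ?ltry.
  exists (pickle r); first exact: I.
  rewrite /D pickleK rx (le_trans s0 (ltW sr)).
  by apply/andP; rewrite !bnd_simp s0 ltW.
Qed.

Lemma ae_eq_integral_domain d' (T : measurableType d') (m : {measure set T -> \bar R})
    (D1 D2 : set T) (f1 f2 : T -> \bar R) :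
  measurable D1 -> measurable D2 ->
  measurable_fun D1 f1 -> measurable_fun D2 f2 ->
  (forall x, D1 x -> 0 <= f1 x) -> (forall x, D2 x -> 0 <= f2 x) ->
  {ae m, forall x, (D1 x <-> D2 x) /\ (D1 x -> f1 x = f2 x)} ->
  \int[m]_(x in D1) f1 x = \int[m]_(x in D2) f2 x.
Proof.
move=> mD1 mD2 mf1 mf2 f10 f20 ff.
rewrite integral_mkcond [RHS]integral_mkcond.
apply: ge0_ae_eq_integral => //.
- exact/(measurable_restrictT _ _).1.
- exact/(measurable_restrictT _ _).1.
- by move=> x _; apply: erestrict_ge0.
- by move=> x _; apply: erestrict_ge0.
move: ff; apply: filterS => x [DD ff] _; rewrite !patchE.
have [D1x|nD1x] := boolP (x \in D1).
  by rewrite mem_set ?ff//; [exact: set_mem|exact/DD/set_mem].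
by rewrite memNset// => /DD D1x; move: nD1x; rewrite mem_set.
Qed.

End excursion.

Section subspace_restriction.
Variables (T : topologicalType) (D1 D2 : set T) (x1 : D1) (x2 : D2).

Lemma measurable_fun_sval_subset d' (U : measurableType d') (f : T -> U) :
  D2 `<=` D1 ->
  measurable_fun [set: borel_on x1] (fun x => f (sval x)) ->
  measurable_fun [set: borel_on x2] (fun x => f (sval x)).
Proof.
move=> D21 mf _ Y mY; rewrite setTI.
have := mf measurableT _ mY; rewrite setTI => /borel_onP[B mB fB].
apply/borel_onP; exists B => //.
have fBE z : D2 z -> Y (f z) <-> B z.
  move=> D2z.
  pose x : borel_on x1 := exist (fun z => is_true (z \in D1)) _
    (mem_set (D21 _ D2z)).
  by have /= -> := congr1 (@^~ x) fB.
by apply/seteqP; split => y /= h; apply/(fBE _ (set_mem (valP y))).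
Qed.

End subspace_restriction.

Section gamma_measurable.
Variables (R : realType) (S : flow_system R).

Lemma open_Eint : open (@Eint R S).
Proof. by apply/sigT_openP => i; exact: (@dom_open R S i). Qed.

(** E° and Gamma are disjoint, since a boundary point of an open set is outside
    of it. *)
Lemma costate_Eint (a : costate S) : ~ Gamma_in a <-> Eint (sval a).
Proof.
split; last exact: Eint_Gamma_disj.
by move=> nG; have [//|Ga] := set_mem (valP a); case: nG.
Qed.

Lemma measurable_Gamma_in : measurable (@Gamma_in R S).
Proof.
rewrite -[X in measurable X]setCK; apply: measurableC.
rewrite (_ : ~` _ = ((fun a => Eint (sval a)) : set (costate S))).
  by apply: measurable_sval; apply: sub_sigma_algebra; exact: open_Eint.
by apply/seteqP; split => a /costate_Eint.
Qed.

Lemma measurable_fun_costate d' (U : measurableType d') (f : ambient S -> U) :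
  measurable_fun [set: prejump S] (fun x => f (sval x)) ->
  measurable_fun [set: costate S] (fun x => f (sval x)).
Proof.
apply: measurable_fun_sval_subset.
by move=> z [zE|zG]; [left; left|right].
Qed.

Lemma measurable_fun_state d' (U : measurableType d') (f : ambient S -> U) :
  measurable_fun [set: prejump S] (fun x => f (sval x)) ->
  measurable_fun [set: state S] (fun x => f (sval x)).
Proof. by apply: measurable_fun_sval_subset => z zE; left. Qed.

End gamma_measurable.

Section first_excursion.
Variables (R : realType) (S : flow_system R) (J : jump_mechanism S).
Variables (d : measure_display) (Omega : measurableType d).
Variable X : pdmp J Omega.
Hypothesis lamc : {within @E R S, continuous (lam J)}.
Local Notation T1 := (jump_time X 1).
Local Notation before_exit := (before_exit (S := S)).
Local Notation upto_exit := (upto_exit (S := S)).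
Local Notation borel := (<<s @open (ambient S)>>).
Local Open Scope ereal_scope.

Section flow_of_function.
Variable f : ambient S -> \bar R.
Hypothesis mf : measurable_fun [set: prejump S] (fun x => f (sval x)).

Lemma measurable_fun_upto_exit :
  measurable_fun upto_exit (fun p => f (flow (sval p.1) p.2)).
Proof.
apply: (measurable_fun_flow X lamc (x0 := exist _ (base S) (base_EGamma S))) => //.
- exact: (measurable_upto_exit X lamc).
- by move=> p [p0 px]; apply: flow_EGamma => //; exact: state_E.
Qed.

Lemma measurable_fun_upto_exit1 (q : state S) :
  measurable_fun [set s | upto_exit (q, s)] (fun s => f (flow (sval q) s)).
Proof.
move=> mU Y mY.
have := measurable_fun_upto_exit (measurable_upto_exit X lamc) mY.
by move=> /(measurable_xsection q); rewrite xsectionE.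
Qed.

End flow_of_function.

Lemma measurable_mu_prejump (B : set (state S)) : measurable B ->
  measurable_fun [set: prejump S] (fun x => mu J (sval x) B).
Proof. exact: mu_measurable. Qed.

Lemma measurable_flow1 (q : state S) (B : set (ambient S)) : borel B ->
  measurable [set s : R | upto_exit (q, s) /\ B (flow (sval q) s)].
Proof.
move=> mB; have := measurable_flow X lamc mB.
by move=> /(measurable_xsection q); rewrite xsectionE.
Qed.

Lemma measurable_upto_exit1 (q : state S) :
  measurable [set s : R | upto_exit (q, s)].
Proof.
have := measurable_upto_exit X lamc.
by move=> /(measurable_xsection q); rewrite xsectionE.
Qed.

Let measurable_T1_comp (f : R -> \bar R) (C : set R) : measurable C ->
  measurable_fun C f -> measurable_fun (T1 @^-1` C) (f \o T1).
Proof.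
move=> mC mf; apply: (measurable_comp mC) => //.
  by move=> _ [w Cw <-].
exact: measurable_funTS.
Qed.

(** As W_1 = phi(q, T_1), an event on W_1 is an event on T_1, and the given law of
    (T_1, Q_1) applies. *)
Lemma first_jump_pre (q : state S) (C : set R) (A : set (costate S))
    (B : set (state S)) :
  measurable C -> measurable A -> measurable B ->
  Px X q (T1 @^-1` C `&` pre X 1 @^-1` A `&` post X 1 @^-1` B) =
  \int[Px X q]_(w in T1 @^-1` C `&` pre X 1 @^-1` A) mu J (sval (pre X 1 w)) B.
Proof.
move=> mC mA mB; have /borel_onP[A0 mA0 AA0] := mA.
pose C' := C `&` [set s : R | upto_exit (q, s) /\ A0 (flow (sval q) s)].
have mC' : measurable C' by apply: measurableI => //; exact: measurable_flow1.
have CA : {ae Px X q, forall w, (T1 @^-1` C `&` pre X 1 @^-1` A) w <->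
    (T1 @^-1` C') w}.
  apply: filterS2 (T1_le_exit X lamc q) (pre1_flow X lamc q) => w Tx Wf.
  rewrite /C' AA0/= Wf; split => [[Cw Aw]|[Cw [_ Aw]]] //.
  by split => //; split => //; split => //; exact: jump_time1_ge0.
rewrite (ae_iff_measure (B := T1 @^-1` C' `&` post X 1 @^-1` B)); last 3 first.
- apply: measurableI; last exact: measurable_funPTI.
  by apply: measurableI; exact: measurable_funPTI.
- by apply: measurableI; exact: measurable_funPTI.
- by apply: filterS CA => w CA; split => -[/CA].
rewrite first_jump_law//; apply: ae_eq_integral_domain.
- exact: measurable_funPTI.
- by apply: measurableI; exact: measurable_funPTI.
- apply: (@measurable_T1_comp (fun s => mu J (flow (sval q) s) B)) => //.
  apply: (measurable_funS (measurable_upto_exit1 q) _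
    (@measurable_fun_upto_exit1 (mu J ^~ B) (measurable_mu_prejump mB) q)).
  by move=> s [_ []].
- apply: measurable_funTS.
  apply: (@measurableT_comp _ _ _ _ _ _ (fun x : costate S => mu J (sval x) B)) => //.
  exact: (@measurable_fun_costate _ _ _ _ (mu J ^~ B) (measurable_mu_prejump mB)).
- by [].
- by [].
apply: filterS2 CA (pre1_flow X lamc q) => w CA Wf.
by split; [split => /CA|move=> _; rewrite Wf].
Qed.

Section compensator.
Variable g : ambient S -> \bar R.
Hypothesis mg : measurable_fun [set: prejump S] (fun x => g (sval x)).
Hypothesis g0 : forall x, 0 <= g x.

(** lam g along the flow, and 0 outside of the lifetime, in particular at
    negative times. *)
Definition flow_rate (p : state S * R) : \bar R :=
  (flow_lam J p)%:E * ((fun p => g (flow (sval p.1) p.2)) \_ before_exit) p.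

Lemma flow_rate_ge0 p : 0 <= flow_rate p.
Proof.
by apply: mule_ge0; [rewrite lee_fin flow_lam_ge0|exact: erestrict_ge0].
Qed.

Lemma measurable_flow_rate : measurable_fun setT flow_rate.
Proof.
apply: emeasurable_funM.
  by apply/measurable_EFinP; exact: (measurable_flow_lam X lamc).
apply: (measurable_restrictT _ (measurable_before_exit X lamc)).1.
exact: (measurable_funS (measurable_upto_exit X lamc) (@before_upto R S)
  (@measurable_fun_upto_exit g mg)).
Qed.

(** Unforced jumps have the compensator lam(X_s) ds: T_1 has the density
    lam(phi(q, s)) P_q(T_1 > s) before the exit time, and Fubini's theorem
    moves P_q(T_1 > s) out of the integral over s. *)
Lemma first_free_jump (q : state S) (C : set R) : measurable C ->
  \int[Px X q]_(w in T1 @^-1` C `&` pre X 1 @^-1` (~` @Gamma_in R S))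
    g (sval (pre X 1 w)) =
  \int[Px X q]_w \int[lebR]_s
    (flow_rate (q, s) * (\1_[set s | C s /\ (s < T1 w)%R] s)%:E).
Proof.
move=> mC; pose C' := C `&` lifetime q.
have mC' : measurable C'.
  by apply: measurableI => //; exact: (measurable_lifetime X lamc).
have mgq : measurable_fun C' (fun s => g (flow (sval q) s)).
  apply: (measurable_funS (measurable_upto_exit1 q) _
    (@measurable_fun_upto_exit1 g mg q)).
  by move=> s [_ /lifetimeE[s0 /ltW sx]].
transitivity (\int[law_from X q]_(w in T1 @^-1` C') g (flow (sval q) (T1 w))).
  apply: ae_eq_integral_domain => //.
  - apply: measurableI; first exact: measurable_funPTI.
    by apply: measurable_funPTI; apply: measurableC; exact: measurable_Gamma_in.
  - exact: measurable_funPTI.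
  - apply: measurable_funTS.
    apply: (@measurableT_comp _ _ _ _ _ _ (fun x : costate S => g (sval x))) => //.
    exact: measurable_fun_costate.
  - exact: (@measurable_T1_comp (fun s => g (flow (sval q) s))).
  apply: filterS2 (T1_le_exit X lamc q) (pre1_flow X lamc q) => w Tx Wf.
  split; last by move=> _; rewrite Wf.
  have T0 := jump_time1_ge0 X w.
  have [c _ [_ fE fG]] := flow_exit (state_E q).
  rewrite /C' /Gamma_in /= Wf; split => -[Cw].
    move=> nG; split => //; apply/lifetimeE; split => //.
    rewrite lt_neqAle Tx andbT; apply/eqP => Tex; apply: nG; exact: fG.
  move=> /lifetimeE[_ Tlx]; split => //.
  move: T0; rewrite le_eqVlt => /predU1P[T0|T0].
    rewrite -T0 flow0; last exact: state_E.
    move=> Gq; move: Tlx; rewrite exit_time_Gamma//; last exact: state_E.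
    by rewrite -T0 ltxx.
  by apply: Eint_Gamma_disj; exact: fE.
transitivity (\int[T1_dens X lamc q]_(s in C') g (flow (sval q) s)).
  rewrite -(@ge0_integral_pushforward _ _ _ _ _ T1 _ (law_from X q) C'
    (fun s => g (flow (sval q) s)))//.
  apply: eq_measure_integral => A mA AC'; apply: T1_density => //.
  by move=> s /AC'[].
have mgC : measurable_fun setT ((fun s => g (flow (sval q) s)) \_ C').
  exact/(measurable_restrictT _ _).1.
have gC0 s : 0 <= ((fun s => g (flow (sval q) s)) \_ C') s.
  by apply: erestrict_ge0.
have gd := @integral_mdensity _ R R lebR _ (measurable_T1_pdf X lamc q)
  (T1_pdf_ge0 X q) _ mgC gC0.
transitivity (\int[lebR]_s
  (((fun s => g (flow (sval q) s)) \_ C') s * (T1_pdf X q s)%:E)).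
  by rewrite [LHS]integral_mkcond; exact: gd.
pose G (p : R * Omega) := flow_rate (q, p.1) * (\1_[set p | C p.1 /\ (p.1 < T1 p.2)%R] p)%:E.
have mG : measurable_fun setT G.
  apply: emeasurable_funM.
    apply: (measurableT_comp measurable_flow_rate).
    by apply: measurable_fun_pair => //.
  apply/measurable_EFinP/measurable_indic.
  rewrite (_ : [set _ | _] = [set p | C p.1] `&` [set p | (p.1 < T1 p.2)%R])//.
  apply: measurableI; last exact: measurable_T1_after.
  by rewrite -[X in measurable X]setTI; exact: measurable_fst.
have G0 p : 0 <= G p by rewrite mule_ge0// ?flow_rate_ge0// lee_fin.
have mCT s : measurable [set w | C s /\ (s < T1 w)%R].
  have [Cs|nCs] := pselect (C s).
    rewrite (_ : [set _ | _] = [set w | (s < T1 w)%R]).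
      exact: measurable_T1_gt.
    by apply/seteqP; split => w //= [].
  by rewrite (_ : [set _ | _] = set0)//; apply/seteqP; split => w //= [].
transitivity (\int[lebR]_s \int[law_from X q]_w G (s, w)).
  apply: eq_integral => s _; rewrite /G /=.
  rewrite (eq_integral (fun w => flow_rate (q, s) *
    (\1_[set w | C s /\ (s < T1 w)%R] w)%:E)); last by move=> w _; rewrite !indicE.
  rewrite ge0_integralZl//; last 2 first.
  - by apply/measurable_EFinP; apply: measurable_indic; exact: mCT.
  - exact: flow_rate_ge0.
  rewrite integral_indic//.
  rewrite setIT patchE; case: ifPn => [/set_mem[Cs sL]|sC].
    rewrite (_ : [set w | _] = [set w | (s < T1 w)%R]); last first.
      by apply/seteqP; split => w //= [].
    rewrite /T1_pdf EFinM surviveE /flow_rate patchE mem_set; last exact/lifetimeE.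
    by rewrite muleA; congr (_ * _); rewrite muleC.
  rewrite mul0e; have [Cs|nCs] := pselect (C s); last first.
    rewrite (_ : [set w | _] = set0) ?measure0 ?mule0//.
    by apply/seteqP; split => w //= [].
  rewrite /flow_rate patchE memNset ?mule0 ?mul0e//.
  by move=> /lifetimeE sL; move/negP: sC; apply; rewrite inE.
by rewrite (@fubini_tonelli _ _ _ _ R lebR (law_from X q) G).
Qed.

End compensator.

End first_excursion.

(** * The restart property under a general initial law *)

Section image_measure.
Context d1 d2 (T1 : measurableType d1) (T2 : measurableType d2) (R : realType).
Variables (m : {measure set T1 -> \bar R}) (f : {mfun T1 >-> T2}).
Local Open Scope ereal_scope.

Definition image_measure : set T2 -> \bar R := pushforward m f.

Let image0 : image_measure set0 = 0. Proof. exact: measure0. Qed.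

Let image_ge0 A : 0 <= image_measure A. Proof. exact: measure_ge0. Qed.

Let image_sigma_additive : semi_sigma_additive image_measure.
Proof.
move=> F mF tF mUF; rewrite /image_measure /pushforward preimage_bigcup.
apply: measure_semi_sigma_additive.
- by move=> n; exact: measurable_funPTI.
- apply/trivIsetP => /= i j _ _ ij; rewrite -preimage_setI.
  by move/trivIsetP : tF => /(_ _ _ _ _ ij) ->//; rewrite preimage_set0.
- by rewrite -preimage_bigcup; exact: measurable_funPTI.
Qed.

HB.instance Definition _ := isMeasure.Build _ _ R image_measure
  image0 image_ge0 image_sigma_additive.

End image_measure.

Section projection_mfun.
Context d1 d2 (T1 : measurableType d1) (T2 : measurableType d2).

HB.instance Definition _ := isMeasurableFun.Build _ _ _ _
  (fst : T1 * T2 -> T1) measurable_fst.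
HB.instance Definition _ := isMeasurableFun.Build _ _ _ _
  (snd : T1 * T2 -> T2) measurable_snd.

End projection_mfun.

Section pair_mfun.
Context d0 d1 d2 (T0 : measurableType d0) (T1 : measurableType d1)
  (T2 : measurableType d2).
Variables (f : {mfun T0 >-> T1}) (g : {mfun T0 >-> T2}).

Definition pair_mfun (x : T0) : T1 * T2 := (f x, g x).

Let measurable_pair_mfun : measurable_fun setT pair_mfun.
Proof. by apply: measurable_fun_pair. Qed.

HB.instance Definition _ := isMeasurableFun.Build _ _ _ _ pair_mfun
  measurable_pair_mfun.

End pair_mfun.

Section joint_law.
Context d1 d2 d3 d4 (O1 : measurableType d1) (O2 : measurableType d2)
  (T1 : measurableType d3) (T2 : measurableType d4) (R : realType).
Variables (m1 : {measure set O1 -> \bar R}) (m2 : {measure set O2 -> \bar R}).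
Variables (f1 : {mfun O1 >-> T1}) (g1 : {mfun O1 >-> T2}).
Variables (f2 : {mfun O2 >-> T1}) (g2 : {mfun O2 >-> T2}).
Variables (E1 : set O1) (E2 : set O2).
Hypotheses (mE1 : measurable E1) (mE2 : measurable E2).
Local Open Scope ereal_scope.

Lemma eq_joint_law : m1 setT < +oo ->
  (forall A B, measurable A -> measurable B ->
     m1 (f1 @^-1` A `&` g1 @^-1` B `&` E1) =
     m2 (f2 @^-1` A `&` g2 @^-1` B `&` E2)) ->
  forall D : set (T1 * T2), measurable D ->
  m1 ([set w | D (f1 w, g1 w)] `&` E1) = m2 ([set w | D (f2 w, g2 w)] `&` E2).
Proof.
move=> m1oo m12 D mD.
apply: (@eq_measure_prod _ _ _ _ R
  (image_measure (mrestr m1 mE1) (pair_mfun f1 g1))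
  (image_measure (mrestr m2 mE2) (pair_mfun f2 g2))) => //.
  apply: le_lt_trans m1oo; apply: le_measure => //; rewrite inE//.
  by apply: measurableI => //; exact: measurable_funPTI.
Qed.

End joint_law.

Section mixture.
Context d1 d2 (Y : measurableType d1) (Z : measurableType d2) (R : realType).
Variables (nu : probability Y R) (k : R.-pker Y ~> Z).
Local Open Scope ereal_scope.

(** P_nu, when k is the family (P_x). *)
Definition mixture : set Z -> \bar R :=
  mkcomp (@kcst _ _ unit _ R nu) (kpre k (snd : {mfun (unit * Y)%type >-> Y})) tt.

HB.instance Definition _ := Measure.on mixture.

Lemma mixtureE A : mixture A = \int[nu]_y k y A.
Proof. by []. Qed.

Let mixtureT : mixture setT = 1.
Proof.
rewrite mixtureE; under eq_integral do rewrite prob_kernel.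
by rewrite integral_cst//= mul1e probability_setT.
Qed.

HB.instance Definition _ := Measure_isProbability.Build _ _ _ mixture mixtureT.

Lemma integral_mixture (F : Z -> \bar R) :
  (forall z, 0 <= F z) -> measurable_fun setT F ->
  \int[mixture]_z F z = \int[nu]_y \int[k y]_z F z.
Proof. by move=> F0 mF; rewrite /mixture integral_kcomp. Qed.

Lemma mixture_null A : (forall y, k y A = 0) -> mixture A = 0.
Proof. by move=> kA; rewrite mixtureE integral0_eq. Qed.

End mixture.

Section restart.
Variables (R : realType) (S : flow_system R) (J : jump_mechanism S).
Variables (d : measure_display) (Omega : measurableType d).
Variable X : pdmp J Omega.
Hypothesis lamc : {within @E R S, continuous (lam J)}.
Variable nu : probability (state S) R.
Local Notation T1 := (jump_time X 1).
Local Notation upto_exit := (upto_exit (S := S)).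
Local Notation M := (mixture nu (Px X)).
Local Open Scope ereal_scope.

Definition holding_time (n : nat) (w : Omega) : R :=
  (jump_time X n.+1 w - jump_time X n w)%R.

Let measurable_holding_time n : measurable_fun setT (holding_time n).
Proof. by apply: measurable_funB. Qed.

HB.instance Definition _ n := isMeasurableFun.Build _ _ _ _ (holding_time n)
  (measurable_holding_time n).

(** The law of (w, w'), where w is drawn under P_nu and w' afterwards under
    P_(Q_n(w)). *)
Definition restarted (n : nat) : probability (Omega * Omega)%type R :=
  sdprod M (kpre (Px X) (post X n)).

Lemma restart_mixture n (C0 C : set R) (K B : set (state S)) :
  measurable C0 -> measurable C -> measurable K -> measurable B ->
  M ((jump_time X n @^-1` C0 `&` post X n @^-1` K) `&`
      holding_time n @^-1` C `&` post X n.+1 @^-1` B) =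
  \int[M]_(w in jump_time X n @^-1` C0 `&` post X n @^-1` K)
    Px X (post X n w) (T1 @^-1` C `&` post X 1 @^-1` B).
Proof.
move=> mC0 mC mK mB; set G := _ `&` post X n @^-1` K.
have mG : measurable G by apply: measurableI; exact: measurable_funPTI.
have mU : measurable (T1 @^-1` C `&` post X 1 @^-1` B).
  by apply: measurableI; exact: measurable_funPTI.
have mF : measurable_fun setT (fun w =>
    Px X (post X n w) (T1 @^-1` C `&` post X 1 @^-1` B)).
  exact: (measurable_kernel (kpre (Px X) (post X n)) _ mU).
rewrite integral_mkcond integral_mixture; last 2 first.
- by move=> w; exact: erestrict_ge0.
- by apply: (measurable_restrictT _ mG).1; exact: measurable_funTS.
rewrite mixtureE; apply: eq_integral => x _.
rewrite -integral_mkcond -restart//.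
pose H := [set A : set Omega | exists2 j, (j <= n)%N &
           (exists2 D, measurable D & A = jump_time X j @^-1` D) \/
           (exists2 D, measurable D & A = post X j @^-1` D)].
apply: (@measurableI _ (g_sigma_algebraType H)); apply: sub_sigma_algebra.
  by exists n => //; left; exists C0.
by exists n => //; right; exists K.
Qed.

Lemma restartedE n (D : set (Omega * Omega)) :
  restarted n D = \int[M]_w Px X (post X n w) (xsection D w).
Proof. by []. Qed.

Lemma Px_post0 (q : state S) (K : set (state S)) (U : set Omega) :
  measurable K -> measurable U ->
  Px X q (post X 0 @^-1` K `&` U) = (\1_K q)%:E * Px X q U.
Proof.
move=> mK mU; rewrite indicE.
have mKU : measurable (post X 0 @^-1` K `&` U).
  by apply: measurableI => //; exact: measurable_funPTI.
have [qK|qK] := boolP (q \in K).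
  rewrite mul1e; apply: ae_iff_measure => //.
  apply: filterS (start_ae X q) => w /= w0; rewrite w0.
  by split=> [[]//|]; split => //; exact: set_mem.
rewrite mul0e -(measure0 (Px X q)); apply: ae_iff_measure => //.
apply: filterS (start_ae X q) => w /= w0; rewrite w0.
by split=> // -[qK' _]; move: qK; rewrite mem_set.
Qed.

(** The events on T_n and Q_n belong to the past at T_n, so [restart] fixes their
    joint law with the holding time and Q_(n+1) on rectangles.  On the restarted
    side Q_n is replaced by the starting point of the second path, which is the
    same almost surely. *)
Lemma restart_state_time n (C0 : set R) (B : set (state S))
    (D : set (state S * R)) :
  measurable C0 -> measurable B -> measurable D ->
  M ([set w | D (post X n w, holding_time n w)] `&`
     (jump_time X n @^-1` C0 `&` post X n.+1 @^-1` B)) =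
  restarted n ([set p | D (post X 0 p.2, T1 p.2)] `&`
     [set p | C0 (jump_time X n p.1) /\ B (post X 1 p.2)]).
Proof.
move=> mC0 mB mD.
pose snd2 : {mfun (Omega * Omega)%type >-> Omega} := snd.
pose fst2 : {mfun (Omega * Omega)%type >-> Omega} := fst.
have mE2 : measurable [set p : Omega * Omega |
    C0 (jump_time X n p.1) /\ B (post X 1 p.2)].
  exact: (measurableI _ _ (measurable_funPTI (jump_time X n \o fst2) mC0)
    (measurable_funPTI (post X 1 \o snd2) mB)).
apply: (@eq_joint_law _ _ _ _ Omega (Omega * Omega)%type (state S) R R
  M (restarted n) (post X n) (holding_time n) (post X 0 \o snd2) (T1 \o snd2)
  _ _ _ mE2) => //.
- by apply: measurableI; exact: measurable_funPTI.
- by rewrite (le_lt_trans (probability_le1 _ _)) ?ltry.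
move=> K C mK mC.
transitivity (M ((jump_time X n @^-1` C0 `&` post X n @^-1` K) `&`
    holding_time n @^-1` C `&` post X n.+1 @^-1` B)).
  by congr (mixture _ _ _); apply/seteqP; split => w /=; tauto.
rewrite restart_mixture// integral_mkcond; apply: eq_integral => w _.
have mU : measurable (T1 @^-1` C `&` post X 1 @^-1` B).
  by apply: measurableI; exact: measurable_funPTI.
have sE U : xsection U w = [set w' | U (w, w')] by rewrite xsectionE.
rewrite -[RHS]/(Px X (post X n w) (xsection _ w)) sE patchE; case: ifPn => [/set_mem[C0w Kw]|nG].
  rewrite -[LHS]mul1e; transitivity ((\1_K (post X n w))%:E *
      Px X (post X n w) (T1 @^-1` C `&` post X 1 @^-1` B)).
    by rewrite indicE mem_set.
  rewrite -Px_post0//; congr (Px X _ _).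
  by apply/seteqP; split => w' /=; tauto.
have [C0w|nC0w] := pselect (C0 (jump_time X n w)).
  have nKw : ~ K (post X n w) by move=> Kw; move: nG; rewrite mem_set.
  transitivity ((\1_K (post X n w))%:E *
      Px X (post X n w) (T1 @^-1` C `&` post X 1 @^-1` B)).
    by rewrite indicE memNset ?mul0e.
  rewrite -Px_post0//; congr (Px X _ _).
  by apply/seteqP; split => w' /=; tauto.
rewrite (_ : [set w' | _] = set0) ?measure0//.
by apply/seteqP; split => w' //= [_ []].
Qed.

Let null_ae d' (T : measurableType d') (m : {measure set T -> \bar R})
    (A B : set T) : measurable A -> measurable B ->
  {ae m, forall w, A w <-> B w} <-> m ((A `\` B) `|` (B `\` A)) = 0.
Proof.
move=> mA mB; set N := _ `|` _.
have mN : measurable N by apply: measurableU; exact: measurableD.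
have NE : N = ~` [set w | A w <-> B w].
  apply/seteqP; split => w.
    by move=> [[Aw nBw]|[Bw nAw]] /= [AB BA]; [exact/nBw/AB|exact/nAw/BA].
  move=> /= nAB; have [Aw|nAw] := pselect (A w).
    by left; split => // Bw; apply: nAB.
  by right; split => //; apply: contrapT => nBw; apply: nAB.
split => [/negligibleP|N0]; first by rewrite -NE; move/(_ mN).
by exists N; split => //; rewrite NE.
Qed.

Lemma holding_time0 w : holding_time 0 w = T1 w.
Proof. by rewrite /holding_time jump_time0 subr0. Qed.

Let measurable_state_time n (D : set (state S * R)) : measurable D ->
  measurable [set w | D (post X n w, holding_time n w)].
Proof.
by move=> mD; exact: (measurable_funPTI (pair_mfun (post X n) (holding_time n)) mD).
Qed.

Lemma holding_time_upto_exit n :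
  {ae M, forall w, upto_exit (post X n w, holding_time n w)}.
Proof.
have mU : measurable upto_exit := measurable_upto_exit X lamc.
exists (~` [set w | upto_exit (post X n w, holding_time n w)]); split => //.
  by apply: measurableC; exact: measurable_state_time.
transitivity (M ([set w | (~` upto_exit) (post X n w, holding_time n w)] `&`
    (jump_time X n @^-1` setT `&` post X n.+1 @^-1` setT))).
  by rewrite !preimage_setT !setIT.
rewrite restart_state_time//; last exact: measurableC.
rewrite restartedE integral0_eq// => w _.
rewrite -(measure0 (Px X (post X n w))); apply: ae_iff_measure => //.
  apply: measurable_xsection.
  pose snd2 : {mfun (Omega * Omega)%type >-> Omega} := snd.
  rewrite (_ : _ `&` _ = (fun p => (post X 0 (snd2 p), T1 (snd2 p))) @^-1` (~` upto_exit)).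
    exact: (measurable_funPTI (pair_mfun (post X 0 \o snd2) (T1 \o snd2)) (measurableC mU)).
  by apply/seteqP; split => p //= [].
apply: filterS2 (start_ae X (post X n w)) (T1_le_exit X lamc (post X n w)).
move=> w' w0 Tx; split => // /xsectionP[/= + _]; rewrite w0; apply.
by split => //; exact: jump_time1_ge0.
Qed.

(** W_(n+1) is the flow from Q_n after the holding time, up to the exit time of
    Q_n, which the holding time almost surely does not exceed.  The same D
    serves for all n and for the first jump from q. *)
Lemma pre_event (A : set (costate S)) : measurable A ->
  exists D : set (state S * R), [/\ measurable D,
    forall q, {ae Px X q, forall w,
      (pre X 1 @^-1` A) w <-> D (post X 0 w, T1 w)} &
    forall n, {ae M, forall w,
      (pre X n.+1 @^-1` A) w <-> D (post X n w, holding_time n w)}].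
Proof.
move=> /[dup] mA /borel_onP[A0 mA0 AA0].
pose D := upto_exit `&` [set p | A0 (flow (sval p.1) p.2)].
have mD : measurable D by exact: (measurable_flow X lamc).
have D1 q : {ae Px X q, forall w,
    (pre X 1 @^-1` A) w <-> D (post X 0 w, T1 w)}.
  apply: filterS3 (start_ae X q) (T1_le_exit X lamc q) (pre1_flow X lamc q).
  move=> w w0 Tx Wf; rewrite AA0/= Wf w0; split => [Aw|[]//].
  by split => //; split => //; exact: jump_time1_ge0.
have mDn n := measurable_state_time n mD.
have mAn n : measurable (pre X n @^-1` A) by exact: measurable_funPTI.
exists D; split => // -[|n].
  apply: (proj2 (null_ae M (mAn 1%N) (mDn 0%N))); apply: mixture_null => q.
  apply: (proj1 (null_ae (Px X q) (mAn 1%N) (mDn 0%N))).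
  by apply: filterS (D1 q) => w Dw; rewrite /= holding_time0.
apply: filterS (holding_time_upto_exit n.+1) => w Uw.
rewrite AA0/= pre_flow ?jump_time_lt//.
by split => [Aw|[]//]; split.
Qed.

(** [restart] speaks of T_(n+1) and Q_(n+1) only.  By [pre_event], W_(n+1) is
    determined by Q_n and the holding time, so that [restart_state_time] covers
    the events on W_(n+1) too; rectangles then determine the joint law. *)
Lemma restart_law n (D : set (R * (R * (costate S * state S)))) : measurable D ->
  M [set w | D (jump_time X n w, (holding_time n w, Z X n.+1 w))] =
  restarted n [set p | D (jump_time X n p.1, (T1 p.2, Z X 1 p.2))].
Proof.
move=> mD.
pose snd2 : {mfun (Omega * Omega)%type >-> Omega} := snd.
pose fst2 : {mfun (Omega * Omega)%type >-> Omega} := fst.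
have fin : M setT < +oo by rewrite (le_lt_trans (probability_le1 _ _)) ?ltry.
rewrite -[X in M X]setIT -[X in restarted n X]setIT.
pose Zn : {mfun Omega >-> (costate S * state S)%type} :=
  pair_mfun (pre X n.+1) (post X n.+1).
pose Z1 : {mfun (Omega * Omega)%type >-> (costate S * state S)%type} :=
  pair_mfun (pre X 1 \o snd2) (post X 1 \o snd2).
apply: (@eq_joint_law _ _ _ _ Omega (Omega * Omega)%type R
  (R * (costate S * state S))%type R M (restarted n) (jump_time X n)
  (pair_mfun (holding_time n) Zn) (jump_time X n \o fst2)
  (pair_mfun (T1 \o snd2) Z1)) => //.
move=> C0 D1 mC0 mD1; rewrite !setIT setIC [in RHS]setIC.
apply: (@eq_joint_law _ _ _ _ Omega (Omega * Omega)%type R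
  (costate S * state S)%type R M (restarted n) (holding_time n) Zn
  (T1 \o snd2) Z1 (jump_time X n @^-1` C0) ((jump_time X n \o fst2) @^-1` C0)) => //.
- exact: measurable_funPTI.
- exact: (measurable_funPTI (jump_time X n \o fst2) mC0).
move=> C D2 mC mD2; rewrite (setIC _ (Zn @^-1` D2)) -setIA.
rewrite [in RHS](setIC _ (Z1 @^-1` D2)) -[in RHS]setIA.
apply: (@eq_joint_law _ _ _ _ Omega (Omega * Omega)%type (costate S) (state S) R
  M (restarted n) (pre X n.+1) (post X n.+1) (pre X 1 \o snd2)
  (post X 1 \o snd2) (holding_time n @^-1` C `&` jump_time X n @^-1` C0)
  ((T1 \o snd2) @^-1` C `&` (jump_time X n \o fst2) @^-1` C0)) => //.
- by apply: measurableI; exact: measurable_funPTI.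
- exact: (measurableI _ _ (measurable_funPTI (T1 \o snd2) mC)
    (measurable_funPTI (jump_time X n \o fst2) mC0)).
move=> A B mA mB.
have [DA [mDA DA1 DAn]] := pre_event mA.
pose DC := DA `&` [set p | C p.2].
have mDC : measurable DC.
  apply: measurableI => //.
  by rewrite -[X in measurable X]setTI; exact: measurable_snd.
have RR := restart_state_time n mC0 mB mDC.
have L : M ([set w | DC (post X n w, holding_time n w)] `&`
     (jump_time X n @^-1` C0 `&` post X n.+1 @^-1` B)) =
   M (pre X n.+1 @^-1` A `&` post X n.+1 @^-1` B
   `&` (holding_time n @^-1` C `&` jump_time X n @^-1` C0)).
  apply: ae_iff_measure.
  - apply: measurableI; first exact: measurable_state_time.
    by apply: measurableI; exact: measurable_funPTI.
  - by apply: measurableI; apply: measurableI; exact: measurable_funPTI.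
  - by apply: filterS (DAn n) => w; rewrite /DC/=; tauto.
apply: (eq_trans (esym L)); apply: (eq_trans RR); apply: ae_iff_measure.
- exact: (measurableI _ _
    (measurable_funPTI (pair_mfun (post X 0 \o snd2) (T1 \o snd2)) mDC)
    (measurableI _ _ (measurable_funPTI (jump_time X n \o fst2) mC0)
       (measurable_funPTI (post X 1 \o snd2) mB))).
- exact: (measurableI _ _
    (measurableI _ _ (measurable_funPTI (pre X 1 \o snd2) mA)
       (measurable_funPTI (post X 1 \o snd2) mB))
    (measurableI _ _ (measurable_funPTI (T1 \o snd2) mC)
       (measurable_funPTI (jump_time X n \o fst2) mC0))).
suff : {ae restarted n, forall p,
    A (pre X 1 p.2) <-> DA (post X 0 p.2, T1 p.2)}.
  by apply: filterS => p; rewrite /DC/=; tauto.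
have mA1 : measurable (pre X 1 @^-1` A) by exact: measurable_funPTI.
have mDA1 : measurable [set w | DA (post X 0 w, T1 w)].
  exact: (measurable_funPTI (pair_mfun (post X 0) T1) mDA).
apply: (proj2 (null_ae (restarted n) (measurable_funPTI snd2 mA1)
  (measurable_funPTI snd2 mDA1))).
apply: (eq_trans (restartedE n _)); apply: integral0_eq => w _.
rewrite -[X in xsection X w]/(snd @^-1` (((pre X 1 @^-1` A) `\`
  [set w | DA (post X 0 w, T1 w)]) `|` ([set w | DA (post X 0 w, T1 w)] `\`
  (pre X 1 @^-1` A)))) xsection_preimage_snd.
exact: (proj1 (null_ae (Px X (post X n w)) mA1 mDA1) (DA1 (post X n w))).
Qed.

End restart.

(** * The intensity measure of the jumps *)

Section restart_integrals.
Variables (R : realType) (S : flow_system R) (J : jump_mechanism S).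
Variables (d : measure_display) (Omega : measurableType d).
Variable X : pdmp J Omega.
Hypothesis lamc : {within @E R S, continuous (lam J)}.
Variable nu : probability (state S) R.
Local Notation T1 := (jump_time X 1).
Local Notation M := (mixture nu (Px X)).
Local Open Scope ereal_scope.

Let fst2 : {mfun (Omega * Omega)%type >-> Omega} := fst.
Let snd2 : {mfun (Omega * Omega)%type >-> Omega} := snd.

Definition Zmfun (n : nat) : {mfun Omega >-> (costate S * state S)%type} :=
  pair_mfun (pre X n) (post X n).

Lemma integral_restart n (F : R * (R * (costate S * state S)) -> \bar R) :
  (forall x, 0 <= F x) -> measurable_fun setT F ->
  \int[M]_w F (jump_time X n w, (holding_time X n w, Z X n.+1 w)) =
  \int[M]_w \int[Px X (post X n w)]_w' F (jump_time X n w, (T1 w', Z X 1 w')).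
Proof.
move=> F0 mF.
pose f1 := pair_mfun (jump_time X n) (pair_mfun (holding_time X n) (Zmfun n.+1)).
pose f2 : {mfun (Omega * Omega)%type >-> (R * (R * (costate S * state S)))%type} :=
  pair_mfun (jump_time X n \o fst2) (pair_mfun (T1 \o snd2) (Zmfun 1 \o snd2)).
transitivity (\int[image_measure M f1]_x F x).
  by rewrite ge0_integral_pushforward// preimage_setT.
transitivity (\int[image_measure (restarted X nu n) f2]_x F x).
  apply: eq_measure_integral => D mD _.
  exact: (restart_law X lamc nu n mD).
rewrite ge0_integral_pushforward// preimage_setT.
rewrite (@integral_sdprod _ _ _ _ R M (kpre (Px X) (post X n)) (F \o f2))//.
- by move=> p; exact: F0.
- exact: (measurableT_comp mF (measurable_funPT f2)).
Qed.

Lemma integral_restart_state n (F : R * (state S * R) -> \bar R) :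
  (forall x, 0 <= F x) -> measurable_fun setT F ->
  \int[M]_w F (jump_time X n w, (post X n w, holding_time X n w)) =
  \int[M]_w \int[Px X (post X n w)]_w' F (jump_time X n w, (post X n w, T1 w')).
Proof.
move=> F0 mF.
pose f1 := pair_mfun (jump_time X n) (pair_mfun (post X n) (holding_time X n)).
pose f2 : {mfun (Omega * Omega)%type >-> (R * (state S * R))%type} :=
  pair_mfun (jump_time X n \o fst2) (pair_mfun (post X 0 \o snd2) (T1 \o snd2)).
transitivity (\int[image_measure M f1]_x F x).
  by rewrite ge0_integral_pushforward// preimage_setT.
transitivity (\int[image_measure (restarted X nu n) f2]_x F x).
  apply: eq_measure_integral => D mD _.
  have fin : M setT < +oo by rewrite (le_lt_trans (probability_le1 _ _)) ?ltry.
  rewrite -[X in _ = image_measure _ _ X]setIT -[D]setIT.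
  have := @eq_joint_law _ _ _ _ Omega (Omega * Omega)%type R
    (state S * R)%type R M (restarted X nu n) (jump_time X n)
    (pair_mfun (post X n) (holding_time X n)) (jump_time X n \o fst2)
    (pair_mfun (post X 0 \o snd2) (T1 \o snd2)) setT setT measurableT
    measurableT fin _ D mD.
  rewrite !setIT; apply => C D1 mC mD1.
  have := restart_state_time X nu n mC measurableT mD1.
  rewrite preimage_setT !setIT => h; rewrite setIC; apply: (eq_trans h).
  congr (sdprod _ _ _).
  by apply/seteqP; split => p /=; tauto.
rewrite ge0_integral_pushforward// preimage_setT.
rewrite (@integral_sdprod _ _ _ _ R M (kpre (Px X) (post X n)) (F \o f2))//; last 2 first.
- by move=> p; exact: F0.
- exact: (measurableT_comp mF (measurable_funPT f2)).
apply: eq_integral => w _ /=.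
apply: ae_eq_integral_domain => //.
- apply: (measurableT_comp (measurableT_comp mF (measurable_funPT f2))).
  exact: measurable_pair1.
- apply: (measurableT_comp mF); apply: measurable_fun_pair => //.
  exact: measurable_fun_pair.
apply: filterS (start_ae X (post X n w)) => w' w0; split => // _.
by rewrite -w0.
Qed.

Lemma measurable_jumped n (t : R) :
  measurable [set w | (jump_time X n w <= t)%R].
Proof.
rewrite (_ : [set _ | _] = jump_time X n @^-1` `]-oo, t]%classic).
  exact: measurable_funPTI.
by apply/seteqP; split => w /=; rewrite in_itv.
Qed.

Definition jumped (n : nat) (t : R) : Omega -> R :=
  \1_[set w | (jump_time X n w <= t)%R].

Let measurable_jumped_ind n t : measurable_fun setT (jumped n t).
Proof. exact/measurable_indic/measurable_jumped. Qed.

Let jumped_ge0 n t w : (0 <= jumped n t w)%R.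
Proof. by []. Qed.

(** The expected number of jumps (W, Q) in a set, during [0, t] and under
    P_nu. *)
Definition jump_intensity (t : R) : {measure set (costate S * state S) -> \bar R} :=
  mseries (fun n => image_measure
    (mdensity M (measurable_jumped_ind n.+1 t) (@jumped_ge0 n.+1 t))
    (Zmfun n.+1)) 0.

Lemma integral_jump_intensity t (f : costate S * state S -> \bar R) :
  (forall z, 0 <= f z) -> measurable_fun setT f ->
  \int[jump_intensity t]_z f z =
  \sum_(0 <= n <oo) \int[M]_w (f (Z X n.+1 w) * (jumped n.+1 t w)%:E).
Proof.
move=> f0 mf; rewrite /jump_intensity ge0_integral_measure_series//.
apply: eq_eseriesr => n _.
rewrite ge0_integral_pushforward// preimage_setT.
apply: integral_mdensity; first exact: (measurableT_comp mf (measurable_funPT (Zmfun n.+1))).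
by move=> w; exact: f0.
Qed.

Lemma jump_intensityE t (D : set (costate S * state S)) : measurable D ->
  jump_intensity t D =
  \sum_(0 <= n <oo) M [set w | (jump_time X n.+1 w <= t)%R /\ D (Z X n.+1 w)].
Proof.
move=> mD; transitivity (\int[jump_intensity t]_z (\1_D z)%:E).
  by rewrite integral_indic// setIT.
rewrite integral_jump_intensity//; last exact/measurable_EFinP/measurable_indic.
apply: eq_eseriesr => n _.
set E := [set w | _ /\ _].
have mE : measurable E.
  apply: measurableI; first exact: measurable_jumped.
  exact: (measurable_funPTI (Zmfun n.+1) mD).
transitivity (\int[M]_w (\1_E w)%:E); last by rewrite integral_indic// setIT.
apply: eq_integral => w _; rewrite -EFinM; congr EFin.
rewrite /jumped (_ : E = [set w | (jump_time X n.+1 w <= t)%R] `&`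
  [set w | D (Z X n.+1 w)])// indicI/= mulrC; congr (_ * _)%R.
Qed.

Let Tn_holding n w : (jump_time X n w + holding_time X n w = jump_time X n.+1 w)%R.
Proof. by rewrite /holding_time addrC subrK. Qed.

Let measurable_before (t : R) d' (T : measurableType d') :
  measurable ([set x | x.1 + x.2.1 <= t]%R : set (R * (R * T))).
Proof.
pose f (x : R * (R * T)) : R := (x.1 + x.2.1)%R.
have mf : measurable_fun setT f.
  by apply: measurable_funD => //; exact: measurableT_comp.
rewrite (_ : [set _ | _] = f @^-1` `]-oo, t]%classic).
  by rewrite -[X in measurable X]setTI; exact: mf.
by apply/seteqP; split => x /=; rewrite in_itv.
Qed.

(** T_(n+1) <= t is the condition T_n + s <= t on the holding time s, which
    becomes T_1 of the path restarted at Q_n. *)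
Lemma integral_jump_restart n t (f : costate S * state S -> \bar R) :
  (forall z, 0 <= f z) -> measurable_fun setT f ->
  \int[M]_w (f (Z X n.+1 w) * (jumped n.+1 t w)%:E) =
  \int[M]_w \int[Px X (post X n w)]_(w' in
    T1 @^-1` [set s | (jump_time X n w + s <= t)%R]) f (Z X 1 w').
Proof.
move=> f0 mf.
pose F (x : R * (R * (costate S * state S))) : \bar R :=
  f x.2.2 * (\1_[set x : R * (R * (costate S * state S)) | (x.1 + x.2.1 <= t)%R] x)%:E.
have mF : measurable_fun setT F.
  apply: emeasurable_funM.
    by apply: (measurableT_comp mf); exact: measurableT_comp.
  by apply/measurable_EFinP; apply: measurable_indic; exact: measurable_before.
have F0 x : 0 <= F x by rewrite mule_ge0// lee_fin.
have := integral_restart n F0 mF; rewrite /F /= => FE.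
transitivity (\int[M]_w F (jump_time X n w, (holding_time X n w, Z X n.+1 w))).
  apply: eq_integral => w _; rewrite /F /jumped !indicE /=.
  congr (_ * _%:R%:E); congr nat_of_bool.
  by apply/idP/idP => /set_mem/= h; apply/mem_set; rewrite /= ?Tn_holding// -Tn_holding.
rewrite FE; apply: eq_integral => w _.
rewrite [RHS]integral_mkcond; apply: eq_integral => w' _.
rewrite patchE indicE; case: ifPn => h.
  by rewrite mem_set ?mule1//; exact: set_mem.
by rewrite memNset ?mule0//= => h'; move: h; rewrite mem_set.
Qed.

(** Whatever the time of the jump, given W the point Q has law mu at W: this is
    [first_jump_pre] for each of the restarted paths. *)
Lemma jump_intensity_rect t (A : set (costate S)) (B : set (state S)) :
  measurable A -> measurable B ->
  jump_intensity t (A `*` B) =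
  \int[jump_intensity t]_z ((\1_A z.1)%:E * mu J (sval z.1) B).
Proof.
move=> mA mB.
have mAB : measurable (A `*` B) by exact: measurableX.
have mC w n : measurable [set s | (jump_time X n w + s <= t)%R].
  rewrite (_ : [set _ | _] = `]-oo, (t - jump_time X n w)%R]%classic)//.
  by apply/seteqP; split => s /=; rewrite in_itv/= lerBrDl.
have mg : measurable_fun [set: costate S] (fun x : costate S => mu J (sval x) B).
  exact: (@measurable_fun_costate _ _ _ _ (mu J ^~ B) (measurable_mu_prejump J mB)).
have mf : measurable_fun setT
    (fun z : costate S * state S => (\1_A z.1)%:E * mu J (sval z.1) B).
  apply: emeasurable_funM.
    by apply/measurable_EFinP; apply: (measurableT_comp (measurable_indic mA)).
  exact: (measurableT_comp mg).
transitivity (\int[jump_intensity t]_z (\1_(A `*` B) z)%:E).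
  by rewrite integral_indic// setIT.
have f0 (z : costate S * state S) : 0 <= (\1_A z.1)%:E * mu J (sval z.1) B.
  by rewrite mule_ge0// lee_fin.
have mI : measurable_fun setT
    (fun z : costate S * state S => (\1_(A `*` B) z : R)%:E).
  exact/measurable_EFinP/measurable_indic.
have I0 (z : costate S * state S) : 0 <= (\1_(A `*` B) z : R)%:E.
  by rewrite lee_fin.
rewrite (integral_jump_intensity t I0 mI) (integral_jump_intensity t f0 mf).
apply: eq_eseriesr => n _.
rewrite (integral_jump_restart n t I0 mI) (integral_jump_restart n t f0 mf).
apply: eq_integral => w _.
have mpA : measurable (pre X 1 @^-1` A) by exact: measurable_funPTI.
have mT : measurable (T1 @^-1` [set s | (jump_time X n w + s <= t)%R]).
  exact: measurable_funPTI.
have mTA := measurableI _ _ mT mpA.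
transitivity (Px X (post X n w) (T1 @^-1` [set s | (jump_time X n w + s <= t)%R]
    `&` pre X 1 @^-1` A `&` post X 1 @^-1` B)).
  rewrite (eq_integral (EFin \o \1_((pre X 1 @^-1` A) `&` (post X 1 @^-1` B)))); last first.
    by move=> w' _; rewrite /= !indicE.
  rewrite integral_indic//; first by congr (Px X _ _); rewrite setIC setIA.
  by apply: measurableI => //; exact: measurable_funPTI.
rewrite (first_jump_pre X lamc)// integral_mkcondr.
by apply: eq_integral => w' _; rewrite epatch_indic muleC !indicE.
Qed.

End restart_integrals.

(** * Forced and unforced jumps *)

Section campbell.
Variables (R : realType) (S : flow_system R) (J : jump_mechanism S).
Variables (d : measure_display) (Omega : measurableType d).
Variable X : pdmp J Omega.
Variable nu : probability (state S) R.
Hypothesis hnu : standing_assumptions X nu.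
Local Notation T1 := (jump_time X 1).
Local Notation M := (mixture nu (Px X)).
Local Notation xi := (jump_intensity X nu).
Local Open Scope ereal_scope.

Let lamc : {within @E R S, continuous (lam J)} := B3 hnu.

Section forced_jumps.
Variable sigma : {finite_measure set (costate S) -> \bar R}.
Hypothesis hsigma : boundary_measure X nu sigma.

(** Both sides are the expected number of forced jumps in G during [0, t], by
    the definition of sigma. *)
Lemma forced_intensity (t : R) (G : set (costate S)) : (0 < t)%R ->
  measurable G -> G `<=` @Gamma_in R S ->
  xi t (fst @^-1` G) = t%:E * sigma G.
Proof.
move=> t0 mG GG.
have mE n : measurable [set v | (jump_time X n.+1 v <= t)%R /\ G (pre X n.+1 v)].
  apply: measurableI; first exact: measurable_jumped.
  exact: measurable_funPTI.
have mI n : measurable_fun setT (fun w =>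
    (\1_[set v | (jump_time X n.+1 v <= t)%R /\ G (pre X n.+1 v)] w : R)%:E).
  exact/measurable_EFinP/measurable_indic.
rewrite (hsigma t0 mG GG) muleCA -EFinM mulfV ?gt_eqF// mule1.
rewrite jump_intensityE; last first.
  by rewrite -[X in measurable X]setTI; exact: measurable_fst.
rewrite -integral_mixture; last 2 first.
- by move=> w; apply: nneseries_ge0 => n _ _; rewrite lee_fin.
- exact: ge0_emeasurable_sum.
rewrite integral_nneseries//.
by apply: eq_eseriesr => n _; rewrite integral_indic// setIT.
Qed.

Lemma integral_forced_intensity (t : R) (G : set (costate S))
    (f : costate S -> \bar R) : (0 < t)%R ->
  measurable G -> G `<=` @Gamma_in R S ->
  measurable_fun setT f -> (forall a, 0 <= f a) ->
  \int[xi t]_z ((\1_G z.1)%:E * f z.1) = t%:E * \int[sigma]_(a in G) f a.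
Proof.
move=> t0 mG GG mf f0.
have mGf : measurable_fun setT (fun a => (\1_G a)%:E * f a).
  by apply: emeasurable_funM => //; exact/measurable_EFinP/measurable_indic.
have t0' : (0 <= t)%R by exact: ltW.
pose fstc : {mfun (costate S * state S)%type >-> costate S} := fst.
transitivity (\int[image_measure (xi t) fstc]_a ((\1_G a)%:E * f a)).
  rewrite ge0_integral_pushforward// ?preimage_setT// => a _.
  by rewrite mule_ge0// lee_fin.
transitivity (\int[mscale (NngNum t0') sigma]_(a in G) f a).
  transitivity (\int[image_measure (xi t) fstc]_(a in G) f a).
    rewrite [RHS]integral_mkcond; apply: eq_integral => a _.
    by rewrite epatch_indic/= muleC.
  apply: eq_measure_integral => A mA AG.
  by apply: forced_intensity => //; exact: subset_trans AG GG.
by rewrite ge0_integral_mscale//; exact: measurable_funTS.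
Qed.

End forced_jumps.

(** If T_n <= r for all n then infinitely many jumps occur before r, and by A3
    the number of jumps in a bounded time has a finite expectation. *)
Lemma no_explosion (r : R) : {ae M, forall w, exists n, (r < jump_time X n.+1 w)%R}.
Proof.
pose B := \bigcap_n [set w | (jump_time X n.+1 w <= r)%R].
have mB : measurable B by apply: bigcapT_measurable => n; exact: measurable_jumped.
suff B0 : M B = 0.
  exists B; split => // w /= /forallNP h n _ /=.
  by have /negP := h n; rewrite -leNgt.
apply: mixture_null => x; apply/eqP; rewrite -measure_le0.
(* A3 is about positive times only. *)
pose t := (Num.max r 0 + 1)%R.
have t0 : (0 < t)%R by rewrite /t ltr_wpDl// le_max lexx orbT.
have rt : (r <= t)%R by rewrite /t ler_wpDr// le_max lexx.
have := A3 hnu x t0.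
have mjc : measurable_fun setT (jump_count X t).
  apply: ge0_emeasurable_sum => // n _.
  apply/measurable_EFinP; apply: measurable_indic; exact: measurable_jumped.
rewrite leNgt => Joo; apply/negP => PB0.
have : \int[Px X x]_(w in B) +oo <= \int[Px X x]_w jump_count X t w.
  rewrite [leLHS]integral_mkcond; apply: ge0_le_integral => //.
  - by move=> w _; apply: erestrict_ge0.
  - by apply/(measurable_restrictT _ mB).1; exact: measurable_cst.
  - move=> w _; rewrite patchE; case: ifPn => [/set_mem Bw|_]; last first.
      by apply: nneseries_ge0 => n _ _; rewrite lee_fin.
    rewrite leye_eq; apply/eqP/eqyP => A A0.
    have u0 n (_ : true) : 0 <= (\1_[set v | (jump_time X n.+1 v <= t)%R] w : R)%:E.
      by rewrite lee_fin.
    apply: le_trans (nneseries_lim_ge (Num.truncn A).+1 (fun n _ _ => u0 n isT)).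
    rewrite (eq_bigr (fun=> 1)); last first.
      by move=> n _; rewrite indicE mem_set//= (le_trans (Bw n I)).
    by rewrite sumEFin lee_fin big_const_nat subn0 iter_addr addr0 ltW// truncnS_gt.
rewrite integral_cst// gt0_mulye; last exact: PB0.
by rewrite leye_eq => /eqP h; rewrite h ltxx in Joo.
Qed.

Lemma jump_time_homo w : {homo (fun n => jump_time X n w) : m n / (m <= n)%N >-> (m <= n)%R}.
Proof.
apply: homo_leq => // [x y z|n]; first exact: le_trans.
case: n => [|n]; last exact/ltW/jump_time_lt.
by rewrite jump_time0 jump_time1_ge0.
Qed.

Section free_jumps.
Variable g : ambient S -> \bar R.
Hypothesis mg : measurable_fun [set: prejump S] (fun x => g (sval x)).
Hypothesis g0 : forall x, 0 <= g x.
Variable t : R.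

(** The value of lam g at X_r if T_n <= r < T_(n+1) and r <= t; the condition
    T_n <= r is implicit, as [flow_rate] vanishes at negative times. *)
Definition free_rate n (p : R * Omega) : \bar R :=
  flow_rate J g (post X n p.2, (p.1 - jump_time X n p.2)%R) *
  (\1_[set p : R * Omega | (p.1 <= t)%R /\ (p.1 < jump_time X n.+1 p.2)%R] p)%:E.

Lemma free_rate_ge0 n p : 0 <= free_rate n p.
Proof. by rewrite mule_ge0// ?flow_rate_ge0// lee_fin. Qed.

Lemma measurable_free_rate n : measurable_fun setT (free_rate n).
Proof.
apply: emeasurable_funM.
  apply: (measurableT_comp (measurable_flow_rate X lamc mg)).
  apply: measurable_fun_pair; first exact: measurableT_comp.
  by apply: measurable_funB => //; exact: measurableT_comp.
apply/measurable_EFinP/measurable_indic.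
rewrite (_ : [set _ | _] = [set p | (p.1 <= t)%R] `&`
  [set p | (p.1 < jump_time X n.+1 p.2)%R])//; apply: measurableI.
  rewrite (_ : [set _ | _] = fst @^-1` `]-oo, t]%classic); last first.
    by apply/seteqP; split => p /=; rewrite in_itv.
  by rewrite -[X in measurable X]setTI; exact: measurable_fst.
rewrite -[X in measurable X]setTI.
have := @measurable_fun_ltr _ (R * Omega)%type R setT fst (jump_time X n.+1 \o snd).
move=> /(_ measurable_fst (measurableT_comp (measurable_funPT (jump_time X n.+1)) measurable_snd)).
by move=> /(_ measurableT [set true]) /=; rewrite preimage_true; apply.
Qed.

Let excursion_rate (x : R * (state S * R) * R) : \bar R :=
  flow_rate J g (x.1.2.1, x.2) *
  (\1_[set x : R * (state S * R) * R | (x.1.1 + x.2 <= t)%R /\ (x.2 < x.1.2.2)%R] x)%:E.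

Let excursion_rate_ge0 x : 0 <= excursion_rate x.
Proof. by rewrite mule_ge0// ?flow_rate_ge0// lee_fin. Qed.

Let measurable_excursion_rate : measurable_fun setT excursion_rate.
Proof.
apply: emeasurable_funM.
  apply: (measurableT_comp (measurable_flow_rate X lamc mg)).
  apply: measurable_fun_pair => //.
  exact: (measurableT_comp measurable_fst (measurableT_comp measurable_snd measurable_fst)).
apply/measurable_EFinP/measurable_indic.
rewrite (_ : [set _ | _] = [set x | (x.1.1 + x.2 <= t)%R] `&`
  [set x | (x.2 < x.1.2.2)%R])//; apply: measurableI.
  pose f (x : R * (state S * R) * R) : R := (x.1.1 + x.2)%R.
  have mf : measurable_fun setT f.
    by apply: measurable_funD => //; exact: (measurableT_comp measurable_fst).
  rewrite (_ : [set _ | _] = f @^-1` `]-oo, t]%classic).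
    by rewrite -[X in measurable X]setTI; exact: mf.
  by apply/seteqP; split => x /=; rewrite in_itv.
rewrite -[X in measurable X]setTI.
have := @measurable_fun_ltr _ (R * (state S * R) * R)%type R setT snd
  (fun x => x.1.2.2).
move=> /(_ measurable_snd).
move=> /(_ (measurableT_comp measurable_snd (measurableT_comp measurable_snd measurable_fst))).
by move=> /(_ measurableT [set true]) /=; rewrite preimage_true; apply.
Qed.

(** [first_free_jump] for the path restarted at Q_n, with its time s shifted to
    r = T_n + s. *)
Lemma integral_free_jump n :
  \int[M]_w ((\1_(~` @Gamma_in R S) (Z X n.+1 w).1)%:E * g (sval (Z X n.+1 w).1) *
    (jumped X n.+1 t w)%:E) =
  \int[M]_w \int[lebR]_r free_rate n (r, w).
Proof.
pose f (z : costate S * state S) : \bar R :=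
  (\1_(~` @Gamma_in R S) z.1)%:E * g (sval z.1).
have mGc : measurable (~` @Gamma_in R S).
  by apply: measurableC; exact: measurable_Gamma_in.
have f0 z : 0 <= f z by rewrite mule_ge0// lee_fin.
have mf : measurable_fun setT f.
  apply: emeasurable_funM.
    by apply/measurable_EFinP; apply: (measurableT_comp (measurable_indic mGc)).
  exact: (measurableT_comp (measurable_fun_costate mg)).
apply: (eq_trans (integral_jump_restart X lamc nu n t f0 mf)).
pose F (x : R * (state S * R)) := \int[lebR]_s excursion_rate (x, s).
have F0 x : 0 <= F x by apply: integral_ge0.
have mF : measurable_fun setT F.
  by apply: (@measurable_fun_fubini_tonelli_F _ _ _ _ _ lebR excursion_rate).
have mC c : measurable [set s | (c + s <= t)%R].
  rewrite (_ : [set _ | _] = `]-oo, (t - c)%R]%classic)//.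
  by apply/seteqP; split => s /=; rewrite in_itv/= lerBrDl.
transitivity (\int[M]_w \int[Px X (post X n w)]_w' F (jump_time X n w, (post X n w, T1 w'))).
  apply: eq_integral => w _.
  have h := first_free_jump X lamc mg g0 (post X n w) (mC (jump_time X n w)).
  rewrite integral_mkcondr in h; apply: eq_trans h.
  apply: eq_integral => w' _; rewrite patchE /f /= indicE.
  case: ifPn => [/set_mem h|h]; first by rewrite mem_set ?mul1e.
  by rewrite memNset ?mul0e// => h'; move: h; rewrite mem_set.
rewrite -(integral_restart_state X nu n F0 mF); apply: eq_integral => w _.
pose k (s : R) := excursion_rate ((jump_time X n w, (post X n w, holding_time X n w)), s).
have mk : measurable_fun setT k by apply: measurableT_comp => //; exact: measurable_pair1.
rewrite -[LHS]/(\int[lebR]_s k s) -(ge0_integral_shift (jump_time X n w) mk)//.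
  apply: eq_integral => r _; rewrite /k /excursion_rate /free_rate /= !indicE.
  congr (_ * _%:R%:E); congr nat_of_bool; apply/idP/idP => /set_mem/= h; apply/mem_set => /=;
  by move: h; rewrite /holding_time addrC subrK ltrD2r.
by move=> s; exact: excursion_rate_ge0.
Qed.

(** The intervals [T_n, T_(n+1)[ tile the half-line of times, by [no_explosion],
    so at most one term of the sum is nonzero: the one whose interval contains
    r. *)
Lemma sum_free_rate (r : R) :
  {ae M, forall w, \sum_(0 <= n <oo) free_rate n (r, w) =
    (\1_`[0%R, t] r)%:E * ((lam J (sval (traj X r w)))%:E * g (sval (traj X r w)))}.
Proof.
have early n w : (r < jump_time X n w)%R -> free_rate n (r, w) = 0.
  move=> rT; rewrite /free_rate /flow_rate /flow_lam patchE memNset ?mul0e//.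
  by move=> [/= +]; rewrite subr_ge0 leNgt rT.
have [r0|r0] := ltP r 0%R.
  apply: aeW => w; rewrite indicE memNset ?mul0e; last first.
    by rewrite /= in_itv/= => /andP[+ _]; rewrite leNgt r0.
  rewrite eseries0// => n _ _; apply: early; apply: lt_le_trans r0 _.
  by rewrite -(jump_time0 X w); exact: jump_time_homo.
have [tr|rt] := ltP t r.
  apply: aeW => w; rewrite indicE memNset ?mul0e; last first.
    by rewrite /= in_itv/= => /andP[_ +]; rewrite leNgt tr.
  rewrite eseries0// => n _ _; rewrite /free_rate indicE memNset ?mule0//=.
  by move=> -[+ _]; rewrite leNgt tr.
(* The holding times do not exceed the exit times, hence the flow at time r has
   not reached Gamma. *)
have eU : {ae M, forall w n, upto_exit (post X n w, holding_time X n w)}.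
  by apply/ae_foralln => n; exact: holding_time_upto_exit.
apply: filterS2 (no_explosion r) eU => w ex Uw.
case: (ex_minnP ex) => n rTn nmin.
have Tnr : (jump_time X n w <= r)%R.
  case: n nmin {rTn} => [|n] nmin; first by rewrite jump_time0.
  by rewrite leNgt; apply/negP => /nmin; rewrite ltnn.
rewrite (@nneseriesD1 _ _ n predT)//; last by move=> k _; exact: free_rate_ge0.
rewrite eseries0 ?adde0; last first.
  move=> k _ /andP[_ /negP kn]; have [kn'|nk] := ltP k n.
    rewrite /free_rate indicE memNset ?mule0//= => -[_].
    rewrite ltNge => /negP; apply; apply: le_trans Tnr.
    exact: jump_time_homo.
  apply: early; apply: lt_le_trans rTn _; apply: jump_time_homo.
  by rewrite ltn_neqAle eq_sym; apply/andP; split => //; exact/negP.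
rewrite indicE mem_set ?mul1e/=; last by rewrite in_itv/= r0.
rewrite /free_rate indicE mem_set// mule1 (traj_flow Tnr rTn).
have be : before_exit (post X n w, (r - jump_time X n w)%R).
  split => /=; first by rewrite subr_ge0.
  have [_ /= h] := Uw n; apply: lt_le_trans h.
  by rewrite lte_fin ltrD2r.
by rewrite /flow_rate /flow_lam !patchE mem_set.
Qed.

(** By [sum_free_rate] the left-hand side is the integral over r in [0, t] of the
    expectation of lam(X_r) g(X_r), and X_r has law nu for all r. *)
Lemma integral_free_intensity : (0 < t)%R ->
  \int[xi t]_z ((\1_(~` @Gamma_in R S) z.1)%:E * g (sval z.1)) =
  t%:E * \int[nu]_x ((lam J (sval x))%:E * g (sval x)).
Proof.
move=> t0.
have mGc : measurable (~` @Gamma_in R S).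
  by apply: measurableC; exact: measurable_Gamma_in.
have mf : measurable_fun setT (fun z : costate S * state S =>
    (\1_(~` @Gamma_in R S) z.1)%:E * g (sval z.1)).
  apply: emeasurable_funM.
    by apply/measurable_EFinP; apply: (measurableT_comp (measurable_indic mGc)).
  exact: (measurableT_comp (measurable_fun_costate mg)).
rewrite integral_jump_intensity//; last first.
  by move=> z; rewrite mule_ge0// lee_fin.
pose H (x : state S) := (lam J (sval x))%:E * g (sval x).
have H0 x : 0 <= H x by rewrite mule_ge0// lee_fin lam_ge0.
have mH : measurable_fun setT H.
  apply: emeasurable_funM; last exact: measurable_fun_state.
  by apply/measurable_EFinP; exact: lam_measurable.
have mf2 n r : measurable_fun setT (fun w => free_rate n (r, w)).
  by apply: measurableT_comp (measurable_free_rate n) _; exact: measurable_pair1.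
transitivity (\int[lebR]_r \int[M]_w \sum_(0 <= n <oo) free_rate n (r, w)).
  transitivity (\sum_(0 <= n <oo) \int[lebR]_r \int[M]_w free_rate n (r, w)).
    apply: eq_eseriesr => n _; rewrite integral_free_jump.
    rewrite [RHS](@fubini_tonelli _ _ _ _ R lebR M (free_rate n))//.
      exact: measurable_free_rate.
    exact: free_rate_ge0.
  rewrite -integral_nneseries//.
  - apply: eq_integral => r _; rewrite integral_nneseries//.
    by move=> n w _; exact: free_rate_ge0.
  - move=> n; apply: (@measurable_fun_fubini_tonelli_F _ _ _ _ _ M (free_rate n)).
      exact: measurable_free_rate.
    exact: free_rate_ge0.
  - by move=> n r _; apply: integral_ge0 => w _; exact: free_rate_ge0.
have stat r : (0 <= r)%R -> \int[M]_w H (traj X r w) = \int[nu]_x H x.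
  move=> r0; transitivity (\int[image_measure M (traj X r)]_x H x).
    by rewrite ge0_integral_pushforward// preimage_setT.
  by apply: eq_measure_integral => A mA _; exact: (B1 hnu r0 mA).
transitivity (\int[lebR]_(r in `[0%R, t]) \int[nu]_x H x).
  rewrite [RHS]integral_mkcond; apply: eq_integral => r _.
  have mHr : measurable_fun setT (fun w => H (traj X r w)) by exact: measurableT_comp.
  transitivity (\int[M]_w ((\1_`[0%R, t] r)%:E * H (traj X r w))).
    apply: ae_eq_integral => //.
    - by apply: ge0_emeasurable_sum => // n w _ _; exact: free_rate_ge0.
    - exact: measurable_funeM.
    - by apply: filterS (sum_free_rate r) => w h _.
  rewrite ge0_integralZl//.
  rewrite patchE indicE; case: ifPn => [/set_mem/=|_]; last by rewrite mul0e.
  by rewrite in_itv/= => /andP[r0 _]; rewrite mul1e stat.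
rewrite integral_cst// muleC; congr (_ * _).
transitivity (@lebesgue_measure R `[0%R, t]%classic); first by [].
by rewrite lebesgue_measure_itv/= lte_fin t0 sube0.
Qed.

End free_jumps.

End campbell.

(** * Campbell's formula and the measure pi *)

Section campbell_formula.
Variables (R : realType) (S : flow_system R) (J : jump_mechanism S).
Variables (d : measure_display) (Omega : measurableType d).
Variable X : pdmp J Omega.
Variable nu : probability (state S) R.
Hypothesis hnu : standing_assumptions X nu.
Variable sigma : {finite_measure set (costate S) -> \bar R}.
Hypothesis hsigma : boundary_measure X nu sigma.
Local Notation M := (mixture nu (Px X)).
Local Notation xi := (jump_intensity X nu).
Local Notation Gamma_in := (@Gamma_in R S).
Local Open Scope ereal_scope.

Let lamc : {within @E R S, continuous (lam J)} := B3 hnu.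

(** A set of E*, seen in E, is a Borel trace cut with E° or Gamma; Gamma is
    measurable in E because its points are those with exit time 0. *)
Lemma measurable_state_costate (A : set (costate S)) : measurable A ->
  measurable [set x : state S | exists2 a, A a & sval a = sval x].
Proof.
move=> /borel_onP[A0 mA0 AA0].
rewrite (_ : [set x | _] = ((fun x => A0 (sval x)) : set (state S)) `&`
  (((fun x => Eint (sval x)) : set (state S)) `|` [set x : state S | Gamma (sval x)])).
  apply: measurableI; first exact: measurable_sval.
  apply: measurableU; last exact: (measurable_stateGamma X lamc).
  by apply: measurable_sval; apply: sub_sigma_algebra; exact: open_Eint.
apply/seteqP; split => x.
  move=> [a]; rewrite AA0 => Aa ax; split; first by rewrite -ax.
  have : Estar (sval a) by exact: (set_mem (valP a)).
  by rewrite ax.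
move=> [A0x xE].
pose a : costate S := exist (fun z => is_true (z \in @Estar R S)) (sval x) (mem_set xE).
by exists a => //; rewrite AA0.
Qed.

(** The jumps with W in A and outside Gamma are counted by
    [integral_free_intensity] with g(x) = 1_A(x) mu_x(B).  Here 1_A is taken as
    the indicator of a Borel set A' whose trace on E is the set of the points of
    E that belong to A: on an unforced jump W is in E°, where A and A' agree,
    and on the side of nu that trace is the domain of integration. *)
Lemma jump_intensity_rectE (t : R) (A : set (costate S)) (B : set (state S)) :
  (0 < t)%R -> measurable A -> measurable B ->
  xi t (A `*` B) = t%:E *
    (\int[nu]_(x in [set x : state S | exists2 a, A a & sval a = sval x])
        ((lam J (sval x))%:E * mu J (sval x) B) +
     \int[sigma]_(a in A `&` Gamma_in) mu J (sval a) B).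
Proof.
move=> t0 mA mB; have mD := measurable_state_costate mA.
set D := [set x | _] in mD *.
have mG : measurable Gamma_in := @measurable_Gamma_in R S.
(* A' is Borel in the ambient space and its trace on E is D. *)
have [A' mA' DA'] := (borel_onP _).1 mD.
pose g (x : ambient S) : \bar R := (\1_A' x)%:E * mu J x B.
have g0 x : 0 <= g x by rewrite mule_ge0// lee_fin.
have mg : measurable_fun [set: prejump S] (fun x => g (sval x)).
  apply: emeasurable_funM; last exact: mu_measurable.
  apply/measurable_EFinP.
  have mA'p : measurable ((fun x => A' (sval x)) : set (prejump S)).
    exact: measurable_sval.
  exact: (measurable_indic mA'p).
have mmu : measurable_fun [set: costate S] (fun x : costate S => mu J (sval x) B).
  exact: (@measurable_fun_costate _ _ _ _ (mu J ^~ B) (measurable_mu_prejump J mB)).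
have mAG : measurable (A `&` Gamma_in) by exact: measurableI.
have mGc : measurable (~` Gamma_in) by exact: measurableC.
rewrite (jump_intensity_rect X lamc nu t mA mB).
transitivity (\int[xi t]_z ((\1_(~` Gamma_in) z.1)%:E * g (sval z.1) +
   (\1_(A `&` Gamma_in) z.1)%:E * mu J (sval z.1) B)).
  apply: eq_integral => z _; rewrite /g.
  have [Gz|nGz] := pselect (Gamma_in z.1).
    rewrite [\1_(~` _) _]indicE memNset//= mul0e add0e !indicE.
    by congr ((nat_of_bool _)%:R%:E * _); apply/idP/idP => /set_mem h; apply/mem_set => //; case: h.
  rewrite [\1_(_ `&` _) _]indicE memNset ?mul0e ?adde0; last by case.
  rewrite [\1_(~` _) _]indicE mem_set// mul1e; congr (_%:E * _).
  have Ez : Eint (sval z.1) by exact/costate_Eint.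
  pose x : state S := exist (fun z => is_true (z \in @E R S)) (sval z.1)
    (mem_set (or_introl Ez)).
  have Dx : D x <-> A' (sval z.1).
    by rewrite -[A' (sval z.1)]/((fun x : state S => A' (sval x)) x) DA'.
  rewrite !indicE; congr (_%:R); congr nat_of_bool.
  apply/idP/idP => /set_mem h; apply/mem_set.
    by apply/Dx; exists z.1.
  by have [a Aa /= /val_inj <-] := Dx.2 h.
rewrite ge0_integralD//; last 4 first.
- by move=> z _; rewrite mule_ge0// lee_fin.
- apply: emeasurable_funM.
    by apply/measurable_EFinP; apply: (measurableT_comp (measurable_indic mGc)).
  exact: (measurableT_comp (measurable_fun_costate mg)).
- by move=> z _; rewrite mule_ge0// lee_fin.
- apply: emeasurable_funM; last exact: (measurableT_comp mmu).
  by apply/measurable_EFinP; apply: (measurableT_comp (measurable_indic mAG)).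
rewrite (integral_free_intensity hnu mg g0 t0).
rewrite (integral_forced_intensity hsigma t0 mAG (@subIsetr _ _ _) mmu)//.
rewrite [RHS]ge0_muleDr; last 2 first.
- by apply: integral_ge0 => x _; rewrite mule_ge0// lee_fin lam_ge0.
- by apply: integral_ge0.
congr (_ * _ + _); rewrite [RHS]integral_mkcond; apply: eq_integral => x _.
rewrite patchE /g indicE.
have Dx : D x <-> A' (sval x) by rewrite DA'.
case: ifPn => [/set_mem/Dx A'x|nDx]; first by rewrite mem_set// mul1e.
by rewrite memNset ?mul0e ?mule0// => /Dx; move/negP: nDx; rewrite in_setE.
Qed.

(** Not an instance of [jump_intensity_rectE]: with A = E* the integral there is
    over the points of E that belong to E*, while the norm of xi takes all of
    E into account. *)
Lemma jump_intensityT (t : R) : (0 < t)%R ->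
  xi t setT = t%:E * xi_norm J nu sigma.
Proof.
move=> t0; have mG : measurable Gamma_in := @measurable_Gamma_in R S.
have mGc : measurable (~` Gamma_in) by exact: measurableC.
transitivity (\int[xi t]_z ((\1_(~` Gamma_in) z.1)%:E * 1) +
  \int[xi t]_z ((\1_Gamma_in z.1)%:E * 1)).
  transitivity (\int[xi t]_z ((\1_(~` Gamma_in) z.1)%:E * 1 + (\1_Gamma_in z.1)%:E * 1)).
    transitivity (\int[xi t]_z cst 1 z); first by rewrite integral_cst// mul1e.
    apply: eq_integral => z _; rewrite !mule1 -EFinD !indicE in_setC.
    by case: (_ \in _); rewrite /= ?add0r ?addr0.
  rewrite ge0_integralD//.
  - apply: emeasurable_funM => //.
    by apply/measurable_EFinP; apply: (measurableT_comp (measurable_indic mGc)).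
  - apply: emeasurable_funM => //.
    by apply/measurable_EFinP; apply: (measurableT_comp (measurable_indic mG)).
rewrite (@integral_free_intensity _ _ _ _ _ _ _ hnu (cst 1))//.
rewrite (@integral_forced_intensity _ _ _ _ _ _ _ _ hsigma t _ (cst 1))//.
rewrite integral_cst// mul1e /xi_norm [RHS]ge0_muleDr//; last first.
  by apply: integral_ge0 => x _; rewrite lee_fin lam_ge0.
by under eq_integral do rewrite mule1.
Qed.

Lemma xi_norm_fin_num : xi_norm J nu sigma \is a fin_num.
Proof.
have l0 : 0 <= \int[nu]_x (lam J (sval x))%:E.
  by apply: integral_ge0 => x _; rewrite lee_fin lam_ge0.
rewrite ge0_fin_numE; last by rewrite /xi_norm adde_ge0.
rewrite /xi_norm lte_add_pinfty//; first exact: (B2 hnu).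
by rewrite -ge0_fin_numE// fin_num_measure//; exact: measurable_Gamma_in.
Qed.

(** Otherwise no jump would ever occur under P_nu, though T_1 is finite. *)
Lemma xi_norm_gt0 : 0 < xi_norm J nu sigma.
Proof.
rewrite lt0e; apply/andP; split; last first.
  rewrite /xi_norm adde_ge0//.
  by apply: integral_ge0 => x _; rewrite lee_fin lam_ge0.
apply/eqP => n0.
have T0 k : M [set w | (jump_time X 1 w <= k.+1%:R)%R] = 0.
  have := jump_intensityT (ltr0Sn R k).
  rewrite n0 mule0 jump_intensityE//; under eq_eseriesr.
    move=> n _.
    rewrite (_ : [set w | _ /\ _] = [set w | (jump_time X n.+1 w <= k.+1%:R)%R]).
      over.
    by apply/seteqP; split => w //= [].
  move=> s0; apply/eqP; rewrite -measure_le0 -s0.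
  apply: le_trans (nneseries_lim_ge 1 _); last by [].
  by rewrite big_nat1.
have : M setT = 0.
  rewrite (_ : setT = \bigcup_k [set w | (jump_time X 1 w <= k.+1%:R)%R]); last first.
    apply/seteqP; split => // w _; exists (Num.truncn (jump_time X 1 w)) => //=.
    exact/ltW/truncnS_gt.
  apply/negligibleP; first by apply: bigcupT_measurable => k; exact: measurable_jumped.
  by apply: negligible_bigcup => k; apply/negligibleP; [exact: measurable_jumped|exact: T0].
by rewrite probability_setT => /eqP; rewrite eqe oner_eq0.
Qed.

Lemma jump_intensity_fin (t : R) : (0 < t)%R -> xi t setT < +oo.
Proof.
move=> t0; rewrite jump_intensityT//.
by rewrite -ge0_fin_numE ?mule_ge0 ?lee_fin ?ltW ?fin_numM ?xi_norm_fin_num// xi_norm_gt0.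
Qed.

(** Campbell's formula is linear in t on rectangles, hence on all measurable
    sets. *)
Lemma jump_intensity_linear (t : R) C : (0 < t)%R -> measurable C ->
  xi t C = t%:E * xi 1%R C.
Proof.
move=> t0; have t0' : (0 <= t)%R by exact: ltW.
apply: (@eq_measure_prod _ _ _ _ _ (xi t) (mscale (NngNum t0') (xi 1%R))).
  exact: jump_intensity_fin.
move=> A B mA mB; transitivity (t%:E * xi 1%R (A `*` B)); last by [].
by rewrite (jump_intensity_rectE t0)// (jump_intensity_rectE ltr01)// mul1e.
Qed.

(** The Dirac mass is a default value, which the normalization would return for
    a null or infinite measure. *)
Definition embedded_law : probability (costate S * state S)%type R :=
  mnormalize (xi 1%R) (dirac (point : costate S * state S)).

Lemma embedded_lawE C :
  embedded_law C = ((fine (xi_norm J nu sigma))^-1)%:E * xi 1%R C.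
Proof.
rewrite /embedded_law/= /mnormalize jump_intensityT// mul1e.
rewrite gt_eqF ?xi_norm_gt0//= lt_eqF; first by rewrite muleC.
by rewrite -ge0_fin_numE ?xi_norm_fin_num// ltW// xi_norm_gt0.
Qed.

Lemma jump_intensity_law (t : R) C : (0 < t)%R -> measurable C ->
  xi t C = (t * fine (xi_norm J nu sigma))%:E * embedded_law C.
Proof.
move=> t0 mC; rewrite jump_intensity_linear// embedded_lawE muleA -EFinM.
rewrite mulfK// gt_eqF// fine_gt0// xi_norm_gt0/=.
by rewrite -ge0_fin_numE ?xi_norm_fin_num// ltW// xi_norm_gt0.
Qed.

Lemma embedded_law_is_pi : is_pi J nu sigma embedded_law.
Proof.
by move=> A B mA mB; rewrite embedded_lawE jump_intensity_rectE// mul1e.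
Qed.

End campbell_formula.

(** * Stationarity *)

Lemma nneseries_recS (R : realType) (u : nat -> \bar R) :
  (forall n, 0 <= u n)%E ->
  (\sum_(0 <= n <oo) u n = u 0%N + \sum_(0 <= n <oo) u n.+1)%E.
Proof.
move=> u0; rewrite nneseries_recl//; congr (_ + _)%E.
apply: cvg_lim => //; rewrite -cvg_shiftS/=.
rewrite [X in X @ _ --> _](_ : _ = fun n => (\sum_(0 <= k < n) u k.+1)%E); last first.
  by apply/funext => n; rewrite big_add1.
exact: is_cvg_nneseries.
Qed.

Section stationarity.
Variables (R : realType) (S : flow_system R) (J : jump_mechanism S).
Variables (d : measure_display) (Omega : measurableType d).
Variable X : pdmp J Omega.
Variable nu : probability (state S) R.
Hypothesis lamc : {within @E R S, continuous (lam J)}.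
Local Notation M := (mixture nu (Px X)).
Local Notation xi := (jump_intensity X nu).
Local Open Scope ereal_scope.

Variable C : set (costate S * state S).
Hypothesis mC : measurable C.

Let early_jump n k t := M [set w | (jump_time X n w <= t)%R /\ C (Z X k w)].

Let measurable_early_jump n k t :
  measurable [set w | (jump_time X n w <= t)%R /\ C (Z X k w)].
Proof.
apply: measurableI; first exact: measurable_jumped.
exact: (measurable_funPTI (Zmfun X k) mC).
Qed.

Lemma measurable_Z_kernel : measurable_fun setT (fun z => Z_kernel X z C).
Proof.
have mPx : measurable_fun setT (fun q => Px X q (Z X 1 @^-1` C)).
  exact: (measurable_kernel (Px X) _ (measurable_funPTI (Zmfun X 1) mC)).
exact: (measurableT_comp mPx measurable_snd).
Qed.

(** By the restart property K(Z_n, C) is the conditional probability that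
    Z_(n+1) is in C. *)
Lemma integral_Z_kernel (t : R) :
  \int[xi t]_z Z_kernel X z C = \sum_(0 <= n <oo) early_jump n.+1 n.+2 t.
Proof.
rewrite integral_jump_intensity//; last exact: measurable_Z_kernel.
apply: eq_eseriesr => n _.
pose F (x : R * (R * (costate S * state S))) : \bar R :=
  (\1_`]-oo, t] x.1)%:E * (\1_C x.2.2)%:E.
have F0 x : 0 <= F x by rewrite mule_ge0// lee_fin.
have mF : measurable_fun setT F.
  apply: emeasurable_funM; apply/measurable_EFinP.
    by apply: (measurableT_comp (measurable_indic _)).
  apply: (measurableT_comp (measurable_indic mC)).
  exact: measurableT_comp.
transitivity (\int[M]_w F (jump_time X n.+1 w, (holding_time X n.+1 w, Z X n.+2 w))).
  rewrite (integral_restart X lamc nu n.+1 F0 mF); apply: eq_integral => w _.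
  rewrite /F /= ge0_integralZl//; last first.
    by apply/measurable_EFinP; apply: (measurableT_comp (measurable_indic mC) (measurable_funPT (Zmfun X 1))).
  rewrite muleC; congr (_ * _).
    rewrite (eq_integral (EFin \o \1_(Z X 1 @^-1` C)))//.
    by rewrite integral_indic ?setIT//; exact: (measurable_funPTI (Zmfun X 1) mC).
transitivity (\int[M]_w (\1_[set w | (jump_time X n.+1 w <= t)%R /\ C (Z X n.+2 w)] w)%:E).
  apply: eq_integral => w _; rewrite /F /= -EFinM; congr EFin.
  rewrite (_ : [set w | _] = [set w | (jump_time X n.+1 w <= t)%R] `&` (Z X n.+2 @^-1` C))//.
  by rewrite indicI /=; congr (_ * _)%R.
by rewrite integral_indic// setIT.
Qed.

Let measurable_current n t :
  measurable [set w | (jump_time X n.+1 w <= t < jump_time X n.+2 w)%R].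
Proof.
rewrite (_ : mkset _ = [set w | (jump_time X n.+1 w <= t)%R] `\`
   [set w | (jump_time X n.+2 w <= t)%R]).
  by apply: measurableD; exact: measurable_jumped.
apply/seteqP; split => w /=.
  by move=> /andP[? h]; split => //; apply/negP; rewrite -ltNge.
by move=> [h1 /negP h2]; apply/andP; split; rewrite // ltNge.
Qed.

(** These events are pairwise disjoint. *)
Lemma current_jump (t : R) :
  \sum_(0 <= n <oo) M [set w | (jump_time X n.+1 w <= t < jump_time X n.+2 w)%R] <= 1.
Proof.
pose D n := [set w | (jump_time X n.+1 w <= t < jump_time X n.+2 w)%R].
have mD n : measurable (D n) by exact: measurable_current.
rewrite [leLHS](_ : _ = M (\bigcup_n D n)).
  by rewrite probability_le1//; exact: bigcupT_measurable.
rewrite measure_bigcup//; first by apply: eq_eseriesl => n; rewrite in_setT.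
apply/trivIsetP => i j _ _ ij; apply/seteqP; split => // w [/andP[i1 i2] /andP[j1 j2]].
have lt a b : (a < b)%N -> (jump_time X b.+1 w <= t)%R -> (t < jump_time X a.+2 w)%R -> False.
  move=> ab bt ta; have := jump_time_homo X w (ab : (a.+2 <= b.+1)%N).
  by move=> /le_trans/(_ bt); rewrite leNgt ta.
by move: ij; rewrite neq_ltn => /orP[h|h]; [exact: (lt _ _ h)|exact: (lt _ _ h)].
Qed.

Let early_jump_next n t : early_jump n.+2 n.+2 t <= early_jump n.+1 n.+2 t.
Proof.
apply: le_measure; rewrite ?inE; [exact: measurable_early_jump..|].
by move=> w /= [h Cw]; split => //; apply: le_trans h; exact: jump_time_homo.
Qed.

Let early_jump_last n t : early_jump n.+1 n.+2 t <=
  early_jump n.+2 n.+2 t + M [set w | (jump_time X n.+1 w <= t < jump_time X n.+2 w)%R].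
Proof.
apply: le_trans (measureU2 _ _ _); last 2 first.
- exact: measurable_early_jump.
- exact: measurable_current.
apply: le_measure; rewrite ?inE; first exact: measurable_early_jump.
  by apply: measurableU; [exact: measurable_early_jump|exact: measurable_current].
move=> w /= [Tt Cw]; have [h|h] := leP (jump_time X n.+2 w) t; [by left|right].
by rewrite Tt.
Qed.

Let later_jumps t := \sum_(0 <= n <oo) early_jump n.+2 n.+2 t.

Let intensity_later t : xi t C = early_jump 1 1 t + later_jumps t.
Proof. by rewrite jump_intensityE// nneseries_recS. Qed.

(** Among the jumps n >= 1 with T_n <= t, all but the last one have T_(n+1) <= t:
    so the left-hand side exceeds the number of later jumps by at most
    1. *)
Lemma integral_Z_kernel_upper (t : R) :
  \int[xi t]_z Z_kernel X z C <= xi t C + 1.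
Proof.
rewrite integral_Z_kernel intensity_later.
apply: (@le_trans _ _ (later_jumps t + 1)); last by rewrite leeD2r// leeDr.
apply: (@le_trans _ _ (\sum_(0 <= n <oo) (early_jump n.+2 n.+2 t +
  M [set w | (jump_time X n.+1 w <= t < jump_time X n.+2 w)%R]))).
  by apply: lee_nneseries => // n _; exact: early_jump_last.
by rewrite nneseriesD// leeD2l// current_jump.
Qed.

(** The first jump is the only one counted by xi_t that has no predecessor
    n >= 1. *)
Lemma integral_Z_kernel_lower (t : R) :
  xi t C <= \int[xi t]_z Z_kernel X z C + 1.
Proof.
rewrite integral_Z_kernel intensity_later [leRHS]addeC; apply: leeD.
  exact: probability_le1.
by apply: lee_nneseries => // n _; exact: early_jump_next.
Qed.

End stationarity.

Lemma le_of_growth (R : realType) (c p q : R) : 0 < c ->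
  (forall t, 0 < t -> t * c * p <= t * c * q + 1) -> p <= q.
Proof.
move=> c0 h; rewrite leNgt; apply/negP => qp.
have pq0 : 0 < c * (p - q) by rewrite mulr_gt0// subr_gt0.
(* At this time the left-hand side exceeds the right-hand side by 1. *)
have := h (2 / (c * (p - q))) (divr_gt0 (ltr0Sn _ 1) pq0).
rewrite -lerBlDl -mulrBr -mulrA mulfVK ?gt_eqF//.
by rewrite leNgt ltr1n.
Qed.

Theorem theorem1 (R : realType) (S : flow_system R) (J : jump_mechanism S)
    (d : measure_display) (Omega : measurableType d) (X : pdmp J Omega)
    (nu : probability (state S) R) (hnu : standing_assumptions X nu)
    (sigma : {finite_measure set (costate S) -> \bar R})
    (hsigma : boundary_measure X nu sigma) :
  exists pi : probability (costate S * state S)%type R,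
    [/\ is_pi J nu sigma pi,
        forall pi' : probability (costate S * state S)%type R,
          is_pi J nu sigma pi' -> forall C, measurable C -> pi' C = pi C &
        stationary_for_Z X pi].
Proof.
have lamc : {within @E R S, continuous (lam J)} := B3 hnu.
exists (embedded_law X nu); split.
- exact: embedded_law_is_pi.
- move=> pi' hpi'; apply: eq_measure_prod.
    exact: (le_lt_trans (probability_le1 pi' measurableT) (ltry _)).
  move=> A B mA mB; apply: (eq_trans (hpi' A B mA mB)).
  exact/esym/(embedded_law_is_pi hnu hsigma mA mB).
move=> C mC; set pi := embedded_law X nu.
pose c := fine (xi_norm J nu sigma).
have c0 : (0 < c)%R.
  rewrite fine_gt0// (xi_norm_gt0 hnu hsigma)/=.
  rewrite -ge0_fin_numE ?(xi_norm_fin_num hnu sigma)//.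
  exact/ltW/(xi_norm_gt0 hnu hsigma).
have mK := measurable_Z_kernel X mC.
have K0 z : (0 <= Z_kernel X z C)%E by [].
have xiK t : (0 < t)%R -> (\int[jump_intensity X nu t]_z Z_kernel X z C =
    (t * c)%:E * \int[pi]_z Z_kernel X z C)%E.
  move=> t0; have tc0 : (0 <= t * c)%R by rewrite mulr_ge0// ltW.
  transitivity (\int[mscale (NngNum tc0) pi]_z Z_kernel X z C)%E.
    by apply: eq_measure_integral => D mD _; exact: (jump_intensity_law hnu hsigma).
  by rewrite ge0_integral_mscale.
have Kfin : (\int[pi]_z Z_kernel X z C)%E \is a fin_num.
  rewrite ge0_fin_numE ?integral_ge0//.
  apply: (@le_lt_trans _ _ (\int[pi]_z cst 1 z)%E); last first.
    rewrite integral_cst// mul1e.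
    exact: (le_lt_trans (probability_le1 pi measurableT) (ltry _)).
  apply: ge0_le_integral => //.
  by move=> z _; exact: (probability_le1 (law_from X z.2) (measurable_funPTI (Zmfun X 1) mC)).
have pfin : pi C \is a fin_num by exact: fin_num_measure.
have KE t : (0 < t)%R -> ((t * c * fine (\int[pi]_z Z_kernel X z C))%:E =
    \int[jump_intensity X nu t]_z Z_kernel X z C)%E.
  by move=> t0; rewrite EFinM fineK// -xiK.
have pE t : (0 < t)%R -> ((t * c * fine (pi C))%:E = jump_intensity X nu t C)%E.
  by move=> t0; rewrite EFinM (fineK pfin) (jump_intensity_law hnu hsigma).
rewrite -(fineK Kfin) -(fineK pfin); congr EFin; apply/eqP; rewrite eq_le.
apply/andP; split; apply: (le_of_growth c0) => t t0;
  rewrite -lee_fin EFinD (KE t t0) (pE t t0).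
- exact: integral_Z_kernel_upper.
- exact: integral_Z_kernel_lower.
Qed.
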